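(* Let $m$ and $k$ be positive integers with $m\ge 2k$, and let $\mathcal{H}(m,k)$ be the bipartite Kneser graph. Then for every integer $i\ge 1$, $$\beta_{i,i+1}(\mathcal{H}(m,k))=\sum_{\substack{r+s=i+1\\ r,s\ge 1}}\ \sum_{t=k}^{m-k}\binom{\binom{t}{k}}{r}\binom{m}{t}N_{m,s,m-k}^{=t}.$$
   Context: For positive integers $m,k$ with $m\ge 2k$, write $[m]=\{1,\dots,m\}$. The bipartite Kneser graph $\mathcal{H}(m,k)$ is the finite simple bipartite graph with vertex set the disjoint union $V_1\sqcup V_2$, where $V_1$ is the set of all $k$-element subsets of $[m]$ and $V_2$ is the set of all $(m-k)$-element subsets of $[m]$ (if $m=2k$ the two sides are regarded as disjoint copies); $A\in V_1$ and $B\in V_2$ are joined by an edge if and only if $A\subseteq B$, and there are no other edges. Let $\Bbbk$ be an infinite field. For a finite simple graph $G$, let $R$ be the standard graded polynomial ring over $\Bbbk$ whose variables are in bijection with the vertices of $G$. The edge ideal $I(G)\subset R$ is generated by all products $xy$ of variables corresponding to the endpoints of an edge of $G$. The number $\beta_{i,j}(G)$ denotes the graded Betti number $\beta_{i,j}(R/I(G))$, i.e. the number of copies of $R[-j]$ in homological degree $i$ of the minimal graded free resolution of $R/I(G)$ over $R$. For positive integers $m,q,r$ and a subset $T\subseteq[m]$, let $\mathfrak{S}_{m,q,r}^{=T}$ be the set of all families $\mathcal{A}$ consisting of exactly $q$ distinct $r$-element subsets of $[m]$ such that $\bigcap_{A\in\mathcal{A}}A=T$. Its cardinality depends only on $t=|T|$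 and is denoted $N_{m,q,r}^{=t}$; thus $N_{m,q,r}^{=t}$ counts the families whose intersection is exactly one fixed $t$-element set $T$. Convention: $\binom{a}{b}=0$ for integers $b>a\ge 0$. *)

(* Defs.v *)
From HB Require Import structures.
From mathcomp Require Import all_boot all_order all_fingroup all_algebra.
From mathcomp Require Import mpoly.

Set Implicit Arguments.
Unset Strict Implicit.
Unset Printing Implicit Defensive.

Import GRing.Theory.

Local Open Scope ring_scope.

Definition infinite_field (K : fieldType) : Prop :=
  forall s : seq K, exists x : K, x \notin s.

Record sgraph := SGraph {
  vertex :> finType;
  adj : rel vertex;
  adj_sym : ssrbool.symmetric adj;
  adj_irrefl : irreflexive adj
}.

(* The ideal generated by the g j, for j satisfying P. *)
Definition ideal_gen (R : comNzRingType) (J : finType) (P : pred J)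
    (g : J -> R) : R -> Prop :=
  fun p => exists c : J -> R, p = \sum_(j | P j) c j * g j.

(* The variable of a vertex v is 'X_(enum_rank v). *)
Definition edge_ideal (K : fieldType) (G : sgraph) : {mpoly K[#|G|]} -> Prop :=
  ideal_gen (fun e : G * G => adj e.1 e.2)
    (fun e => 'X_(enum_rank e.1) * 'X_(enum_rank e.2)).

Definition irrelevant_ideal (K : fieldType) (n : nat) : {mpoly K[n]} -> Prop :=
  ideal_gen (fun _ : 'I_n => true) (fun v => 'X_v).

Section Resolution.

Variables (K : fieldType) (n : nat).
Local Notation R := {mpoly K[n]}.

(* The data of a sequence ... -> F_2 -> F_1 -> F_0 -> R / I, where F_i is the
   direct sum of the R[- fshift i a] for a < frank i.  Elements of F_i are row
   vectors, on which matrices act from the right; the map F_0 -> R / I is given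
   by the column faug of representatives in R of the images of the basis. *)
Record free_seq := FreeSeq {
  frank : nat -> nat;
  fshift : forall i, 'I_(frank i) -> nat;
  fdiff : forall i, 'M[R]_(frank i.+1, frank i);
  faug : 'cV[R]_(frank 0)
}.

(* An entry, in row a and column b, of the matrix of a degree-preserving map:
   it is homogeneous of degree (shift of a) - (shift of b), hence zero when
   this difference is negative. *)
Definition homog_entry (p : R) (da db : nat) : bool :=
  if (db <= da)%N then p \is (da - db)%N.-homog else p == 0.

Record graded_free_resolution (I : R -> Prop) (F : free_seq) : Prop := {
  res_diff_homog : forall i a b,
    homog_entry (fdiff F i a b) (fshift a) (fshift b);
  res_aug_homog : forall a, faug F a 0 \is (fshift a).-homog;
  res_aug_surj : forall p : R,
    exists x : 'rV[R]_(frank F 0), I (p - (x *m faug F) 0 0);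
  res_exact0 : forall x : 'rV[R]_(frank F 0),
    I ((x *m faug F) 0 0) <-> exists y, x = y *m fdiff F 0;
  res_exactS : forall i (x : 'rV[R]_(frank F i.+1)),
    x *m fdiff F i = 0 <-> exists y, x = y *m fdiff F i.+1
}.

Definition minimal_graded_free_resolution (I : R -> Prop) (F : free_seq) :
    Prop :=
  graded_free_resolution I F /\
  forall i a b, irrelevant_ideal (fdiff F i a b).

Definition graded_betti (F : free_seq) (i j : nat) : nat :=
  #|[set a : 'I_(frank F i) | fshift a == j]|.

End Resolution.

Section BipartiteKneser.

Variables m k : nat.

Definition kneser_vertex : finType :=
  ({A : {set 'I_m} | #|A| == k} + {B : {set 'I_m} | #|B| == (m - k)%N})%type.

Definition kneser_adj (u v : kneser_vertex) : bool :=
  match u, v with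
  | inl A, inr B => val A \subset val B
  | inr B, inl A => val A \subset val B
  | _, _ => false
  end.

Lemma kneser_adj_sym : ssrbool.symmetric kneser_adj.
Proof. by case=> u [] v. Qed.

Lemma kneser_adj_irrefl : irreflexive kneser_adj.
Proof. by case. Qed.

Definition bipartite_kneser : sgraph := SGraph kneser_adj_sym kneser_adj_irrefl.

End BipartiteKneser.

Definition families (m q r : nat) (T : {set 'I_m}) : {set {set {set 'I_m}}} :=
  [set S : {set {set 'I_m}} |
    [&& #|S| == q, [forall A in S, #|A| == r] & \bigcap_(A in S) A == T]].

(* The number of families depends only on #|T| (card_families), so it may be
   computed for T the set of the t smallest elements. *)
Definition Nfamilies (m q r t : nat) : nat :=
  #|families q r [set x : 'I_m | (x < t)%N]|.

Lemma families_perm (m q r : nat) (T : {set 'I_m}) (s : 'S_m)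
    (S : {set {set 'I_m}}) :
  S \in families q r T -> (fun A : {set 'I_m} => s @: A) @: S \in families q r (s @: T).
Proof.
have injs : injective (fun A : {set 'I_m} => s @: A).
  exact/imset_inj/perm_inj.
rewrite !inE => /and3P[/eqP cS /'forall_implyP rS /eqP capS].
apply/and3P; split; first by rewrite card_imset // cS.
  apply/'forall_implyP => _ /imsetP[A AS ->].
  by rewrite card_imset ?rS //; exact: perm_inj.
apply/eqP/setP => x; have -> : x = s (s^-1%g x) by rewrite permKV.
rewrite (mem_imset _ _ (@perm_inj _ s)) -capS.
apply/bigcapP/bigcapP => h A AS.
  by rewrite -(mem_imset _ _ (@perm_inj _ s)); apply: h; apply: imset_f.
by case/imsetP: AS => B BS ->; rewrite (mem_imset _ _ (@perm_inj _ s)) h.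
Qed.

Lemma perm_of_card (m : nat) (T U : {set 'I_m}) :
  #|T| = #|U| -> exists s : 'S_m, s @: T = U.
Proof.
move=> eTU; pose l (V : {set 'I_m}) := enum V ++ enum (~: V).
have ul V : uniq (l V).
  rewrite cat_uniq !enum_uniq andbT; apply/hasPn => x.
  by rewrite !mem_enum inE.
have sl V : size (l V) = m by rewrite size_cat -!cardE cardsC card_ord.
have ml V x : x \in l V by rewrite mem_cat !mem_enum inE orbN.
have injf : injective (fun x => nth x (l U) (index x (l T))).
  move=> x y; have lt z : (index z (l T) < size (l U))%N.
    by move: (ml T z); rewrite -index_mem !sl.
  rewrite (set_nth_default y) ?lt // => /eqP.
  rewrite nth_uniq ?lt ?ul // => /eqP e.
  by rewrite -(nth_index x (ml T x)) e nth_index.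
exists (perm injf); apply/eqP; rewrite eqEcard.
rewrite card_imset ?eTU ?leqnn ?andbT; last exact: perm_inj.
apply/subsetP => _ /imsetP[x xT ->]; rewrite permE /l.
have lt : (index x (enum T) < size (enum U))%N.
  by rewrite -cardE -eTU cardE index_mem mem_enum.
by rewrite index_cat mem_enum xT nth_cat lt -mem_enum mem_nth.
Qed.

Lemma card_families (m q r : nat) (T : {set 'I_m}) :
  #|families q r T| = Nfamilies m q r #|T|.
Proof.
have le (V W : {set 'I_m}) : #|V| = #|W| ->
    (#|families q r V| <= #|families q r W|)%N.
  move=> /perm_of_card[s <-].
  have injS : injective (fun S : {set {set 'I_m}} =>
    (fun A : {set 'I_m} => s @: A) @: S).
    exact/imset_inj/imset_inj/perm_inj.
  rewrite -(card_imset _ injS); apply/subset_leq_card/subsetP => S'.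
  by move=> /imsetP[S hS ->]; apply: families_perm.
have cT : #|[set x : 'I_m | (x < #|T|)%N]| = #|T|.
  have leT : (#|T| <= m)%N by have := max_card T; rewrite card_ord.
  have injw : injective (widen_ord leT).
    by move=> x y /(congr1 val) /= e; apply: val_inj.
  rewrite -[RHS]card_ord -(card_imset _ injw); apply: eq_card => x.
  rewrite inE; apply/idP/imsetP => [lt|[y _ ->] /=]; last exact: ltn_ord.
  by exists (Ordinal lt) => //; apply: val_inj.
by apply/eqP; rewrite eqn_leq !le.
Qed.

(* Main.v *)
(* The linear strand of a minimal free resolution of R/I, with I generated by
   quadrics, is determined recursively: the generators of degree i + 1 in
   homological degree i are the linear syzygies on those of degree i in
   homological degree i - 1, by exactness, minimality and since
   no generator in homological degree i has degree <= i.  For the edge ideal of a bipartite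
   graph the same recursion is solved by an explicit Koszul-like complex whose
   basis in homological degree i consists of the (i + 1)-element vertex sets S
   that meet both sides and induce a complete bipartite graph, with
   d(e_S) = \sum_u +/- x_u e_(S - u).  Hence the Betti number counts these sets.
   For a Kneser graph such a set is a pair of families (A, B) with every member
   of A contained in T = \bigcap B, and one sums over T. *)

Require Import Defs.
From HB Require Import structures.
From mathcomp Require Import all_boot all_order all_algebra.
From mathcomp Require Import mpoly.
From mathcomp Require Import ring zify.
From Stdlib Require Import IndefiniteDescription.

Set Implicit Arguments.
Unset Strict Implicit.
Unset Printing Implicit Defensive.

(** * Coefficients of homogeneous polynomials and of quadratic forms *)

Section HomogeneousCoefficients.

Local Open Scope ring_scope.
Import GRing.Theory.

Variables (K : fieldType) (n : nat).
Implicit Types p q : {mpoly K[n]}.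

(** In the convolution, [q] is evaluated at divisors of [mu], of degree at most [d]; homogeneity
    kills all of them except [mu] itself, whose cofactor is the constant monomial. If [mdeg mu < d],
    both sides are zero. *)
Lemma mcoeff_mulr_homog p q d (mu : 'X_{1..n}) :
  q \is d.-homog -> (mdeg mu <= d)%N -> (p * q)@_mu = p@_0%MM * q@_mu.
Proof.
move=> hq le_d; rewrite mcoeffM.
have h0 : (mdeg (0%MM : 'X_{1..n}) < (mdeg mu).+1)%N by rewrite mdeg0.
have hmu : (mdeg mu < (mdeg mu).+1)%N by [].
pose k0 := (BMultinom h0, BMultinom hmu).
rewrite (bigD1 k0) /=; last by rewrite add0m.
rewrite big1 ?addr0 // => k /andP[/eqP e /negP ne].
have [d2|d2] := eqVneq (mdeg k.2) d; last first.
  by rewrite (dhomog_nemf_coeff hq d2) mulr0.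
case: ne; have := congr1 mdeg e; rewrite mdegD d2 => de.
have k1 : mdeg k.1 = 0%N by apply/eqP; rewrite -leqn0 -(leq_add2r d) -de.
have k10 : bmnm k.1 = 0%MM by apply/eqP; rewrite -mdeg_eq0 k1.
have k2 : bmnm k.2 = mu by rewrite [RHS]e k10 add0m.
apply/eqP; case: k {e de d2 k1} k10 k2 => k k' /= k10 k2.
by congr pair; exact: val_inj.
Qed.

Lemma homog_const p : p \is 0.-homog -> p = (p@_0%MM)%:MP.
Proof.
move=> hp; apply/mpolyP => mu; rewrite mcoeffC.
have [->|ne] := eqVneq mu 0%MM; first by rewrite mulr1.
by rewrite mulr0 (dhomog_nemf_coeff hp) //= mdeg_eq0.
Qed.

Lemma homog_linear p : p \is 1.-homog -> p = \sum_u p@_U_(u) *: 'X_u.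
Proof.
move=> hp; apply/mpolyP => mu; rewrite raddf_sum /=.
under eq_bigr do rewrite mcoeffZ mcoeffX.
have [/mdeg1P[u /eqP ->]|ne] := boolP (mdeg mu == 1%N).
  rewrite (bigD1 u) //= eqxx mulr1 big1 ?addr0 // => w /negPf ne.
  by rewrite eq_mnm1 ne mulr0.
rewrite (dhomog_nemf_coeff hp) // big1 // => u _.
by case: eqP => [e|_]; rewrite ?mulr0 //; rewrite -e mdeg1 in ne.
Qed.

(** The coefficient at x_u^2 is [c u u] and the one at x_u x_w is [c u w + c w u]. This translates a
    polynomial relation into the scalar conditions of [linear_syzygy]. *)
Lemma quadratic_eq0 (c : 'I_n -> 'I_n -> K) :
  \sum_u \sum_w c u w *: ('X_u * 'X_w) = 0 :> {mpoly K[n]} <->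
  (forall u, c u u = 0) /\ (forall u w, u != w -> c u w + c w u = 0).
Proof.
set s := \sum_u _.
have coef mu : s@_mu = \sum_u \sum_w c u w * (U_(u) + U_(w) == mu)%MM%:R.
  rewrite raddf_sum; apply: eq_bigr => u _; rewrite raddf_sum.
  by apply: eq_bigr => w _; rewrite /= mcoeffZ -mpolyXD mcoeffX.
have eq2 (u w u' w' : 'I_n) : (U_(u) + U_(w) == U_(u') + U_(w'))%MM =
    ((u == u') && (w == w')) || ((u == w') && (w == u')).
  apply/eqP/orP => [e|]; last first.
    by case=> /andP[/eqP-> /eqP->] //; rewrite addmC.
  have := e => /(congr1 (fun f : 'X_{1..n} => f u)).
  rewrite !mnmDE !mnm1E eqxx [u' == u]eq_sym [w' == u]eq_sym.
  have [eu _|nu] := eqVneq u u'.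
    move: e; rewrite eu => /addmI/eqP; rewrite eq_mnm1 => /eqP->.
    by rewrite eqxx; left.
  have [ew _|nw] := eqVneq u w'; last by [].
  move: e; rewrite ew [X in _ = X]addmC => /addmI/eqP.
  by rewrite eq_mnm1 => /eqP->; rewrite eqxx; right.
split=> [s0|[c0 c1]].
  split=> [u|u w nuw].
    move: (coef (U_(u) + U_(u))%MM); rewrite s0 mcoeff0 => /esym.
    rewrite (bigD1 u) //= (bigD1 u) //= !big1 ?eqxx ?mulr1 ?addr0 //.
      by move=> i ni; rewrite big1 // => j _; rewrite eq2 (negPf ni) mulr0.
    by move=> i ni; rewrite eq2 (negPf ni) andbF mulr0.
  move: (coef (U_(u) + U_(w))%MM); rewrite s0 mcoeff0 => /esym.
  rewrite (bigD1 u) //= (bigD1 w) //= (bigD1 w (P := predC1 u)) /=; last first.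
    by rewrite eq_sym.
  rewrite eqxx mulr1 big1 ?addr0; last first.
    by move=> i ni; rewrite eq2 (negPf ni) (negPf nuw) andbF /= mulr0.
  rewrite (bigD1 u) //= addmC eqxx mulr1 big1 ?addr0; last first.
    by move=> i ni; rewrite eq2 [w == u]eq_sym (negPf nuw) eqxx (negPf ni) mulr0.
  rewrite big1 ?addr0 // => i /andP[ni ni'].
  by rewrite big1 // => j _; rewrite eq2 (negPf ni) (negPf ni') mulr0.
apply/mpolyP => mu; rewrite coef mcoeff0.
pose t u w := c u w * (U_(u) + U_(w) == mu)%MM%:R.
have tC u w : u != w -> t u w + t w u = 0.
  by move=> nuw; rewrite /t [(U_(w) + _)%MM]addmC -mulrDl c1 ?mul0r.
have t0 u : t u u = 0 by rewrite /t c0 mul0r.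
(* The diagonal vanishes; transposing the half w < u pairs each term with its mirror image, without
   dividing by 2. *)
rewrite (eq_bigr (fun u : 'I_n => \sum_(w : 'I_n | (u < w)%N) t u w
    + \sum_(w : 'I_n | (w < u)%N) t u w)) => [|u _]; last first.
  rewrite (bigID (fun w : 'I_n => (u < w)%N)) /=; congr (_ + _).
  rewrite (bigID (fun w : 'I_n => (w < u)%N)) /= [X in _ + X]big1 ?addr0.
    by apply: eq_bigl => w; case: ltngtP.
  move=> w; rewrite -!leqNgt => /andP[le1 le2].
  by rewrite -/(t u w) (_ : w = u) //; apply/val_inj/eqP; rewrite eqn_leq le1.
rewrite big_split /= [X in _ + X](exchange_big_dep xpredT) //= -big_split /=.
rewrite big1 // => u _; rewrite -big_split /= big1 // => w lt.
by rewrite tC //; apply: contraTneq lt => ->; rewrite ltnn.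
Qed.

Lemma irrelevant_ideal_mcoeff0 p : irrelevant_ideal p -> p@_0%MM = 0.
Proof.
case=> c ->; rewrite raddf_sum big1 // => u _ /=.
by rewrite (@mcoeff_mulr_homog _ _ 1) ?dhomogX ?mdeg0 //= ?mdeg1 //
  mcoeffX mnm1_eq0 mulr0.
Qed.

End HomogeneousCoefficients.

(** * Uniqueness of linear strands *)

Section LinearStrands.

Local Open Scope ring_scope.
Import GRing.Theory.

Variables (K : fieldType) (I : eqType).

Definition linear_bijection (X Y : lmodType K) (phi : X -> Y) : Prop :=
  [/\ linear phi, injective phi & forall z, exists y, phi y = z].

(* With E u the coefficients at x_u of a matrix of linear forms, this says that
   \sum_u x_u v_u is annihilated by that matrix: the coefficients at x_u^2 and
   x_u x_w vanish. *)
Definition linear_syzygy (X' X : lmodType K) (E : I -> X' -> X)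
    (v : I -> X') : Prop :=
  (forall u, E u (v u) = 0) /\
  (forall u w, u != w -> E w (v u) + E u (v w) = 0).

(** One step of a strand: [E] identifies [X'] with the space of families in [X] subject to [C], so
    [X'] is determined up to isomorphism by [X] and [C]. *)
Definition parametrizes (X' X : lmodType K) (E : I -> X' -> X)
    (C : (I -> X) -> Prop) : Prop :=
  [/\ forall u, linear (E u),
      forall v, C v <-> exists y, forall u, v u = E u y
    & forall y, (forall u, E u y = 0) -> y = 0].

Lemma parametrizes_inj (X' X : lmodType K) (E : I -> X' -> X) C (y z : X') :
  parametrizes E C -> (forall u, E u y = E u z) -> y = z.
Proof.
case=> linE _ injE eq_yz; apply/eqP; rewrite -subr_eq0; apply/eqP/injE => u.
by rewrite addrC -scaleN1r linE eq_yz scaleN1r addNr.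
Qed.

Lemma linear_zero (X Y : lmodType K) (phi : X -> Y) : linear phi -> phi 0 = 0.
Proof. by move=> lin; have := lin (-1) 0 0; rewrite !scaleN1r !addNr. Qed.

Lemma linear_add (X Y : lmodType K) (phi : X -> Y) y z :
  linear phi -> phi (y + z) = phi y + phi z.
Proof. by move=> lin; have := lin 1 y z; rewrite !scale1r. Qed.

(** Applying [phi] coordinatewise carries the families satisfying [CX] onto those satisfying [CY];
    through the two parametrizations this is a map from [X'] to [Y']. *)
Lemma lift_linear_bijection (X' X Y' Y : lmodType K) (E : I -> X' -> X)
    (D : I -> Y' -> Y) CX CY (phi : X -> Y) :
    parametrizes E CX -> parametrizes D CY -> linear_bijection phi ->
    (forall v, CX v <-> CY (fun u => phi (v u))) ->
  exists2 phi' : X' -> Y', linear_bijection phi' &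
    forall u y, phi (E u y) = D u (phi' y).
Proof.
move=> parE parD [linphi injphi surphi] eqC.
have [linE CE _] := parE; have [linD CD _] := parD.
have ex y : exists z, forall u, phi (E u y) = D u z.
  by apply/CD/eqC/CE; exists y.
have [phi' phi'E] := functional_choice _ ex.
exists phi' => //; split.
- move=> a y z; apply: (parametrizes_inj parD) => u.
  by rewrite -phi'E linE linphi linD !phi'E.
- move=> y z eq_yz; apply: (parametrizes_inj parE) => u.
  by apply: injphi; rewrite !phi'E eq_yz.
move=> z; have [v vE] := functional_choice _ (fun u => surphi (D u z)).
have /CE[y yE] : CX v by apply/eqC/CD; exists z.
exists y; apply: (parametrizes_inj parD) => u.
by rewrite -phi'E -yE vE.
Qed.

Lemma linear_syzygy_transfer (X' X Y' Y : lmodType K) (E : I -> X' -> X)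
    (D : I -> Y' -> Y) (phi : X -> Y) (phi' : X' -> Y') (v : I -> X') :
    linear_bijection phi -> (forall u y, phi (E u y) = D u (phi' y)) ->
  linear_syzygy E v <-> linear_syzygy D (fun u => phi' (v u)).
Proof.
move=> [linphi injphi _] comm; rewrite /linear_syzygy.
have phi0 := linear_zero linphi.
split=> -[v0 v1]; split=> [u|u w nuw].
- by rewrite -comm v0.
- by rewrite -!comm -linear_add // v1.
- by apply: injphi; rewrite comm v0.
- by apply: injphi; rewrite linear_add // !comm v1.
Qed.

(** Level 0 carries its own condition [C]: the generators of the ideal are quadrics, so the syzygies
    among them are not those of a matrix of linear forms. *)
Definition syzygy_condition (X : nat -> lmodType K)
    (E : forall i, I -> X i.+1 -> X i) (C : (I -> X 0) -> Prop) (i : nat) :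
    (I -> X i) -> Prop :=
  match i with 0 => C | j.+1 => linear_syzygy (E j) end.

Lemma linear_strand_unique (X Y : nat -> lmodType K)
    (E : forall i, I -> X i.+1 -> X i) (D : forall i, I -> Y i.+1 -> Y i)
    (CX : (I -> X 0) -> Prop) (CY : (I -> Y 0) -> Prop) (phi0 : X 0 -> Y 0) :
    (forall i, parametrizes (E i) (syzygy_condition E CX (i := i))) ->
    (forall i, parametrizes (D i) (syzygy_condition D CY (i := i))) ->
    linear_bijection phi0 ->
    (forall v, CX v <-> CY (fun u => phi0 (v u))) ->
  forall i, exists phi : X i -> Y i, linear_bijection phi.
Proof.
move=> parE parD bij0 eqC0 i.
(* The induction must also carry the agreement of the syzygy conditions, which is what permits the
   next lift. *)
suff [phi bij _] : exists2 phi : X i -> Y i, linear_bijection phi &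
    forall v, syzygy_condition E CX v <->
              syzygy_condition D CY (fun u => phi (v u)) by exists phi.
elim: i => [|i [phi bij eqC]]; first by exists phi0.
have [phi' bij' comm] := lift_linear_bijection (parE i) (parD i) bij eqC.
by exists phi' => // v; exact: (linear_syzygy_transfer v bij comm).
Qed.

End LinearStrands.

(** * Functions on a subtype and their extension by zero *)

Section FunctionsOnSubtypes.

Local Open Scope ring_scope.
Import GRing.Theory.

Variables (K : fieldType) (T : finType) (P : pred T).

Notation subfun := {ffun {x : T | P x} -> K^o}.
Implicit Types y z : subfun.

(** Extending by zero lets sums range over all of [T], with no dependent indices. *)
Definition extend0 y (x : T) : K := if insub x is Some s then y s else 0.

Definition restrict (f : T -> K) : subfun := [ffun s => f (val s)].

Lemma extend0_val y s : extend0 y (val s) = y s.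
Proof. by rewrite /extend0 valK. Qed.

Lemma extend0_out y x : ~~ P x -> extend0 y x = 0.
Proof. by move=> nPx; rewrite /extend0 insubN. Qed.

Lemma restrict_in f x : P x -> extend0 (restrict f) x = f x.
Proof. by move=> Px; rewrite -[x]/(val (exist P x Px)) extend0_val ffunE. Qed.

Lemma restrictK f : (forall x, ~~ P x -> f x = 0) -> extend0 (restrict f) =1 f.
Proof.
move=> f0 x; have [Px|nPx] := boolP (P x); first exact: restrict_in.
by rewrite extend0_out ?f0.
Qed.

Lemma extend0_inj y z : extend0 y =1 extend0 z -> y = z.
Proof. by move=> eq_yz; apply/ffunP => s; rewrite -!extend0_val. Qed.

Lemma extend0_linear a y z x :
  extend0 (a *: y + z) x = a * extend0 y x + extend0 z x.
Proof.
rewrite /extend0; case: insub => [s|]; last by rewrite mulr0 addr0.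
by rewrite !ffunE.
Qed.

Lemma extend00 x : extend0 0 x = 0.
Proof. by rewrite /extend0; case: insub => // s; rewrite ffunE. Qed.

Lemma extend0D y z x : extend0 (y + z) x = extend0 y x + extend0 z x.
Proof. by rewrite -[y]scale1r extend0_linear mul1r scale1r. Qed.

End FunctionsOnSubtypes.

(** The two function spaces have dimensions [#|S|] and [#|T|], and rank-nullity compares them; no
    bijection of the index types is constructed. *)
Lemma linear_bijection_card (K : fieldType) (S T : finType)
    (phi : {ffun S -> K^o} -> {ffun T -> K^o}) :
  linear_bijection phi -> #|S| = #|T|.
Proof.
case=> lin inj sur.
pose L := GRing.isLinear.Build _ _ _ _ phi lin.
pose phiL : {linear {ffun S -> K^o} -> {ffun T -> K^o}} := HB.pack phi L.
have dimE (U : finType) : \dim (fullv : {vspace {ffun U -> K^o}}) = #|U|.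
  by rewrite dimvf /dim /= muln1.
rewrite -dimE -(limg_ker_dim (linfun phiL)) -(dimE T).
have -> : (fullv :&: lker (linfun phiL) = 0)%VS.
  apply/eqP; rewrite capfv; apply/lker0P => y z; rewrite !lfunE; exact: inj.
rewrite dimv0 add0n; congr (\dim _); apply/vspaceP => z; rewrite memvf.
have [y <-] := sur z; apply/memv_imgP; exists y; first exact: memvf.
by rewrite lfunE.
Qed.

(** * The linear strand of a minimal resolution *)

Section ResolutionStrand.

Local Open Scope ring_scope.
Import GRing.Theory.

Variables (K : fieldType) (n : nat).
Local Notation R := {mpoly K[n]}.
Variables (I : R -> Prop) (F : free_seq K n).
Hypothesis minF : minimal_graded_free_resolution I F.
Hypothesis I_scale : forall c p, I p -> I (c *: p).
Hypothesis I_order2 : forall p mu, I p -> (mdeg mu <= 1)%N -> p@_mu = 0.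

Let resF := minF.1.

Lemma fdiff_mcoeff0 i a b : (fdiff F i a b)@_0%MM = 0.
Proof. exact/irrelevant_ideal_mcoeff0/minF.2. Qed.

Lemma fdiff_homog i a b : (fshift b <= fshift a)%N ->
  fdiff F i a b \is (fshift a - fshift b)%N.-homog.
Proof. by move=> le; have := res_diff_homog resF a b; rewrite /homog_entry le. Qed.

(** Entries of negative degree are zero by homogeneity; an entry of degree zero is a constant, and
    minimality leaves only the constant 0. *)
Lemma fdiff_eq0 i (a : 'I_(frank F i.+1)) (b : 'I_(frank F i)) :
  (fshift a <= fshift b)%N -> fdiff F i a b = 0.
Proof.
move=> le; have := res_diff_homog resF a b; rewrite /homog_entry.
case: leqP => [ge|_ /eqP//]; rewrite (eqnP le) => /homog_const ->.
by rewrite fdiff_mcoeff0.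
Qed.

Lemma image_mcoeff0 i (y : 'rV[R]_(frank F i.+1)) b :
  ((y *m fdiff F i) 0 b)@_0%MM = 0.
Proof.
rewrite mxE raddf_sum big1 // => a _ /=.
by rewrite (rmorphM (mcoeff 0%MM)) /= fdiff_mcoeff0 mulr0.
Qed.

(** A zero row makes a basis vector a cycle, hence a boundary; but by minimality boundaries have no
    constant terms, while the basis vector has the entry 1. *)
Lemma fdiff_row_neq0 i a : ~ forall b, fdiff F i a b = 0.
Proof.
move=> a0; have : (delta_mx 0 a : 'rV[R]_(frank F i.+1)) *m fdiff F i = 0.
  by rewrite -rowE; apply/rowP => b; rewrite !mxE.
case/(res_exactS resF) => y /(congr1 (fun x : 'rV_(frank F i.+1) => (x 0 a)@_0%MM)).
by rewrite image_mcoeff0 mxE !eqxx mcoeff1 eqxx => /eqP; rewrite oner_eq0.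
Qed.

(** The module F_0 is a single copy of R. Since 1 lies in the image modulo [I] and [I] has no
    constant terms, some basis vector has an augmentation with nonzero constant term; minimality
    excludes any further basis vector. *)
Lemma resolution_start : exists b0 : 'I_(frank F 0),
  [/\ forall b, b = b0, fshift b0 = 0%N &
      exists2 c, c != 0 & faug F b0 0 = c%:MP].
Proof.
have [x Ix] := res_aug_surj resF 1.
have I0 : I 0 by rewrite -(scale0r (1 - (x *m faug F) 0 0)); exact: I_scale.
have [b0 b0P|all0] := pickP (fun b => (faug F b 0)@_0%MM != 0); last first.
  have := I_order2 (mu := 0%MM) Ix; rewrite mdeg0 => /(_ isT).
  rewrite mcoeffB mcoeff1 eqxx mxE raddf_sum big1 ?subr0 => [/eqP|b _ /=].
    by rewrite oner_eq0.
  rewrite (rmorphM (mcoeff 0%MM)) /=.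
  by move/negbFE/eqP: (all0 b) => ->; rewrite mulr0.
have sb0 : fshift b0 = 0%N.
  apply/eqP; apply: contraNT b0P => nz.
  by rewrite (dhomog_nemf_coeff (res_aug_homog resF b0)) //= mdeg0 eq_sym.
have cb0 : faug F b0 0 = ((faug F b0 0)@_0%MM)%:MP.
  by apply: homog_const; have := res_aug_homog resF b0; rewrite sb0.
exists b0; split=> // [b|]; last by exists (faug F b0 0)@_0%MM.
apply/eqP/negP => /negP ne; set c := (faug F b0 0)@_0%MM in cb0 b0P.
(* The multiple of e_b0 is chosen so that the augmentation kills [z]; then [z] is a boundary, yet
   its entry at [b] is 1. *)
pose z : 'rV[R]_(frank F 0) :=
  delta_mx 0 b - (c^-1 *: faug F b 0) *: delta_mx 0 b0.
have : I ((z *m faug F) 0 0).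
  rewrite mulmxBl -scalemxAl -!rowE !mxE cb0 mulrC mul_mpolyC scalerA divff //.
  by rewrite scale1r subrr.
case/(res_exact0 resF) => y /(congr1 (fun x : 'rV_(frank F 0) => (x 0 b)@_0%MM)).
rewrite image_mcoeff0 !mxE !eqxx (negPf ne) mulr0 subr0 mcoeff1 eqxx => /eqP.
by rewrite oner_eq0.
Qed.

Variable b0 : 'I_(frank F 0).
Hypothesis b0_unique : forall b, b = b0.
Hypothesis b0_shift : fshift b0 = 0%N.
Hypothesis b0_aug : exists2 c, c != 0 & faug F b0 0 = c%:MP.

Lemma exact_at_start (x : 'rV[R]_(frank F 0)) :
  I (x 0 b0) <-> exists y, x = y *m fdiff F 0.
Proof.
have [c nz_c aug_c] := b0_aug.
rewrite -(res_exact0 resF) mxE (bigD1 b0) //= big1 ?addr0; last first.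
  by move=> b; rewrite (b0_unique b) eqxx.
rewrite aug_c mulrC mul_mpolyC; split; first exact: I_scale.
by move/(I_scale c^-1); rewrite scalerA mulVf // scale1r.
Qed.

Lemma generator_mem a : I (fdiff F 0 a b0).
Proof.
have -> : fdiff F 0 a b0 = (delta_mx 0 a *m fdiff F 0 : 'rV__) 0 b0.
  by rewrite -rowE mxE.
by apply/exact_at_start; exists (delta_mx 0 a).
Qed.

Lemma generator_homog a : fdiff F 0 a b0 \is (fshift a).-homog.
Proof. by have := @fdiff_homog 0 a b0; rewrite b0_shift subn0; exact. Qed.

(** A homogeneous element of [I] of degree at most 1 is zero, and above that a shift not exceeding
    all those one step below forces zero entries. Either way a row would vanish, against
    [fdiff_row_neq0]. *)
Lemma fshift_lower_bound i (a : 'I_(frank F i.+1)) : (i.+1 < fshift a)%N.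
Proof.
elim: i a => [|i IHi] a; rewrite ltnNge; apply/negP => le.
  apply: (@fdiff_row_neq0 0 a) => b; rewrite (b0_unique b).
  apply/mpolyP => mu; rewrite mcoeff0.
  have [mu_a|ne] := eqVneq (mdeg mu) (fshift a).
    by apply: I_order2; [exact: generator_mem | rewrite mu_a].
  exact: dhomog_nemf_coeff (generator_homog a) ne.
apply: (@fdiff_row_neq0 i.+1 a) => b.
by apply: fdiff_eq0; apply: leq_trans le (IHi b).
Qed.

(* The level i of the strand sits in homological degree i + 1, where the
   generators of minimal degree have degree i + 2. *)
Definition strand_index i (a : 'I_(frank F i.+1)) : bool := fshift a == i.+2.

Definition strand i := {ffun {a | @strand_index i a} -> K^o}.

(** Between strand generators the entries of the differential are linear forms; this is the
    coefficient matrix of x_u in that block. *)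
Definition strand_map i (u : 'I_n) (y : strand i.+1) : strand i :=
  restrict _ (fun a => \sum_c extend0 y c * (fdiff F i.+1 c a)@_U_(u)).

Definition strand_quadric (y : strand 0) : R :=
  \sum_a extend0 y a *: fdiff F 0 a b0.

Definition quadric_syzygy (v : 'I_n -> strand 0) : Prop :=
  \sum_u 'X_u * strand_quadric (v u) = 0.

(** Vectors supported on the strand generators: [linrow] lies one degree above them, [constrow] in
    their own degree. *)
Let linrow i (v : 'I_n -> strand i) : 'rV[R]_(frank F i.+1) :=
  \row_a \sum_u extend0 (v u) a *: 'X_u.

Let constrow i (y : strand i) : 'rV[R]_(frank F i.+1) :=
  \row_c (extend0 y c)%:MP.

(** Restricting to the strand loses nothing: a target generator off the strand has shift at least
    that of the source, so the entry is zero. *)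
Lemma strand_mapE i u (y : strand i.+1) a :
  extend0 (strand_map u y) a = \sum_c extend0 y c * (fdiff F i.+1 c a)@_U_(u).
Proof.
apply: restrictK => {}a nPa; apply: big1 => c _.
have [/eqP Pc|nPc] := boolP (strand_index c); last first.
  by rewrite extend0_out ?mul0r.
rewrite fdiff_eq0 ?mcoeff0 ?mulr0 // Pc ltn_neqAle eq_sym nPa.
exact: fshift_lower_bound.
Qed.

Lemma constrow_mul i (y : strand i.+1) :
  constrow y *m fdiff F i.+1 = linrow (fun u => strand_map u y).
Proof.
apply/rowP => a; rewrite !mxE.
under [RHS]eq_bigr do rewrite strand_mapE scaler_suml.
rewrite exchange_big /=; apply: eq_bigr => c _; rewrite mxE mul_mpolyC.
under [RHS]eq_bigr do rewrite -scalerA.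
rewrite -scaler_sumr.
have [/eqP Pc|nPc] := boolP (strand_index c); last first.
  by rewrite extend0_out ?scale0r.
congr (_ *: _); have := fshift_lower_bound a.
rewrite leq_eqVlt => /predU1P[Pa|lt]; last first.
  rewrite fdiff_eq0 ?Pc //; apply/esym/big1 => u _.
  by rewrite mcoeff0 scale0r.
apply: homog_linear; have := @fdiff_homog _ c a.
by rewrite Pc -Pa subSn // subnn; apply.
Qed.

(** A cycle is a boundary, and boundaries have no constant terms. *)
Lemma constrow_ker i (y : strand i) : constrow y *m fdiff F i = 0 -> y = 0.
Proof.
case/(res_exactS resF) => x yE; apply: extend0_inj => c.
have := congr1 (fun x : 'rV_(frank F i.+1) => (x 0 c)@_0%MM) yE.
rewrite image_mcoeff0 mxE mcoeffC eqxx mulr1 => ->.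
by rewrite extend00.
Qed.

Lemma linrow_mulS i (v : 'I_n -> strand i.+1) b :
  (linrow v *m fdiff F i.+1) 0 b =
  \sum_u \sum_w extend0 (strand_map w (v u)) b *: ('X_u * 'X_w).
Proof.
rewrite mxE; under eq_bigr do rewrite mxE mulr_suml.
rewrite exchange_big; apply: eq_bigr => u _.
under [RHS]eq_bigr do rewrite strand_mapE scaler_suml.
rewrite exchange_big /=; apply: eq_bigr => c _; rewrite -scalerAl.
under [RHS]eq_bigr do rewrite -scalerA.
rewrite -scaler_sumr.
have [/eqP Pc|nPc] := boolP (strand_index c); last first.
  by rewrite extend0_out ?scale0r.
congr (_ *: _); have := fshift_lower_bound b.
rewrite leq_eqVlt => /predU1P[Pb|lt]; last first.
  rewrite fdiff_eq0 ?Pc // mulr0; apply/esym/big1 => w _.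
  by rewrite mcoeff0 scale0r.
rewrite [fdiff F _ c b]homog_linear ?mulr_sumr.
  apply: eq_bigr => w _; rewrite -scalerAr -homog_linear //.
  by have := @fdiff_homog _ c b; rewrite Pc -Pb subSn // subnn; apply.
by have := @fdiff_homog _ c b; rewrite Pc -Pb subSn // subnn; apply.
Qed.

(** At level 0 the only column is [b0], which gives the relation among quadrics; at higher levels
    the product is a quadratic form in each column and [quadratic_eq0] applies. *)
Lemma linrow_kerP i (v : 'I_n -> strand i) :
  linrow v *m fdiff F i = 0 <-> syzygy_condition strand_map quadric_syzygy v.
Proof.
case: i v => [|i] v /=.
  have E0 : (linrow v *m fdiff F 0) 0 b0 = \sum_u 'X_u * strand_quadric (v u).
    rewrite mxE; under eq_bigr do rewrite mxE mulr_suml.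
    rewrite exchange_big; apply: eq_bigr => u _; rewrite mulr_sumr.
    by apply: eq_bigr => c _; rewrite -scalerAl -scalerAr.
  rewrite /quadric_syzygy -E0; split=> [->|e]; first by rewrite mxE.
  by apply/rowP => b; rewrite (b0_unique b) e mxE.
pose c b u w := extend0 (strand_map w (v u)) b.
split=> [ker|[c0 c1]].
  have quad b : (forall u, c b u u = 0) /\
      (forall u w, u != w -> c b u w + c b w u = 0).
    by apply/quadratic_eq0; rewrite -linrow_mulS ker mxE.
  split=> [u|u w nuw]; apply: extend0_inj => b; rewrite extend00.
    exact: (quad b).1.
  by rewrite extend0D; exact: (quad b).2.
apply/rowP => b; rewrite linrow_mulS mxE; apply/(quadratic_eq0 (c b)).
split=> [u|u w nuw]; first by rewrite /c c0 extend00.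
by rewrite -extend0D c1 // extend00.
Qed.

Lemma strand_parametrizes i :
  parametrizes (@strand_map i) (syzygy_condition strand_map quadric_syzygy (i := i)).
Proof.
split=> [u a y z|v|y y0].
- apply: extend0_inj => b; rewrite extend0_linear !strand_mapE mulr_sumr.
  rewrite -big_split; apply: eq_bigr => c _ /=.
  by rewrite extend0_linear mulrDl mulrA.
- rewrite -linrow_kerP (res_exactS resF); split=> [[Y vE]|[y vE]]; last first.
    exists (constrow y); rewrite constrow_mul; apply/rowP => a; rewrite !mxE.
    by apply: eq_bigr => u _; rewrite vE.
  (* Only constant terms of [Y] on strand generators matter: the entries met have degree at least 1,
     and at least 2 when [c] is off the strand, so the latter do not reach x_u. *)
  exists (restrict _ (fun c => (Y 0 c)@_0%MM)) => u; apply: extend0_inj => a.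
  have [Pa|nPa] := boolP (strand_index a); last by rewrite !extend0_out.
  have := congr1 (fun x : 'rV_(frank F i.+1) => (x 0 a)@_U_(u)) vE.
  rewrite !mxE raddf_sum /= (bigD1 u) //= mcoeffZ mcoeffXU eqxx mulr1.
  rewrite big1 ?addr0 => [->|w /negPf ne]; last by rewrite mcoeffZ mcoeffXU ne mulr0.
  rewrite strand_mapE raddf_sum; apply: eq_bigr => c _ /=.
  have lt_ac : (fshift a < fshift c)%N.
    by rewrite (eqP Pa) fshift_lower_bound.
  rewrite (mcoeff_mulr_homog _ (fdiff_homog (ltnW lt_ac))) ?mdeg1 ?subn_gt0 //.
  have [Pc|nPc] := boolP (strand_index c); first by rewrite restrict_in.
  rewrite extend0_out // mul0r.
  rewrite (dhomog_nemf_coeff (fdiff_homog (ltnW lt_ac))) ?mulr0 //= mdeg1.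
  rewrite (eqP Pa); apply: contraNneq nPc => e; apply/eqP.
  by rewrite -(subnK (ltnW lt_ac)) (eqP Pa) -e.
apply: constrow_ker; rewrite constrow_mul; apply/rowP => a; rewrite !mxE.
by apply: big1 => u _; rewrite y0 extend00 scale0r.
Qed.

Lemma strand_quadricE (y : strand 0) :
  strand_quadric y = (constrow y *m fdiff F 0) 0 b0.
Proof. by rewrite mxE; apply: eq_bigr => c _; rewrite mxE mul_mpolyC. Qed.

Lemma strand_quadric_linear a (y z : strand 0) :
  strand_quadric (a *: y + z) = a *: strand_quadric y + strand_quadric z.
Proof.
rewrite scaler_sumr -big_split; apply: eq_bigr => c _ /=.
by rewrite extend0_linear scalerDl scalerA.
Qed.

Lemma strand_quadric_ker (y : strand 0) : strand_quadric y = 0 -> y = 0.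
Proof.
rewrite strand_quadricE => y0; apply: constrow_ker; apply/rowP => b.
by rewrite (b0_unique b) y0 mxE.
Qed.

Lemma strand_quadric_mem (y : strand 0) : I (strand_quadric y).
Proof. by rewrite strand_quadricE; apply/exact_at_start; exists (constrow y). Qed.

Lemma strand_quadric_homog (y : strand 0) : strand_quadric y \is 2.-homog.
Proof.
apply: rpred_sum => c _.
have [/eqP Pc|nPc] := boolP (strand_index c).
  by apply: rpredZ; have := generator_homog c; rewrite Pc.
by rewrite extend0_out // scale0r rpred0.
Qed.

(** With [strand_quadric_ker], [strand_quadric_mem] and [strand_quadric_homog], this identifies
    level 0 of the strand with the quadratic part of [I]. Generators have degree at least 2, so
    quadratic coefficients see only the constant terms of their multipliers. *)
Lemma strand_quadric_surj p : I p ->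
  exists y, forall mu, mdeg mu = 2 -> (strand_quadric y)@_mu = p@_mu.
Proof.
move=> Ip; have /exact_at_start[Y YE] : I ((\row_b p : 'rV[R]_(frank F 0)) 0 b0).
  by rewrite mxE.
exists (restrict _ (fun c => (Y 0 c)@_0%MM)) => mu mu2.
have := congr1 (fun x : 'rV_(frank F 0) => (x 0 b0)@_mu) YE.
rewrite !mxE => ->; rewrite !raddf_sum; apply: eq_bigr => c _ /=.
rewrite mcoeffZ (mcoeff_mulr_homog _ (generator_homog c)) ?mu2 ?fshift_lower_bound //.
have [Pc|nPc] := boolP (strand_index c); first by rewrite restrict_in.
rewrite extend0_out // mul0r (dhomog_nemf_coeff (generator_homog c)) ?mulr0 //=.
by rewrite mu2 eq_sym.
Qed.

End ResolutionStrand.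

(** * The complex of bicliques *)

Section BicliqueStrand.

Local Open Scope ring_scope.
Import GRing.Theory.

Variables (K : fieldType) (V : finType) (side : pred V) (edge : rel V).
Variable rank : V -> nat.
Hypothesis rank_inj : injective rank.
Hypothesis rank_side : forall u w, ~~ side u -> side w -> (rank u < rank w)%N.
Implicit Types (u w : V) (S T : {set V}).

Definition bisided S : bool :=
  [exists u in S, side u] && [exists u in S, ~~ side u].

Definition biclique S : bool :=
  bisided S &&
  [forall u in S, forall w in S, (side u != side w) ==> edge u w].

Definition biclique_index i S : bool := biclique S && (#|S| == i.+2).

Definition biclique_space i := {ffun {S | biclique_index i S} -> K^o}.

Definition inversion_sign w u : K := if (rank w < rank u)%N then -1 else 1.

(** The Koszul sign: -1 to the number of elements of [S] ranked before [u]. *)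
Definition insertion_sign u S : K := \prod_(w in S) inversion_sign w u.

Definition biclique_map i u (y : biclique_space i.+1) : biclique_space i :=
  restrict _ (fun S =>
    if u \in S then 0 else insertion_sign u S * extend0 y (u |: S)).

(* The vanishing of \sum_u \sum_S z_u(S) x_u x_S in degree 3, see
   biclique_syzygyP: x_u x_S with u in S determines u and S, while x_T arises
   from u and T - u for all u in T. *)
Definition biclique_syzygy (z : V -> biclique_space 0) : Prop :=
  (forall u S, u \in S -> extend0 (z u) S = 0) /\
  (forall T, #|T| = 3 -> \sum_(u in T) extend0 (z u) (T :\ u) = 0).

Lemma bisidedP S :
  reflect (exists u w, [/\ u \in S, w \in S, side u & ~~ side w]) (bisided S).
Proof.
apply: (iffP andP) => [[/exists_inP[u uS su] /exists_inP[w wS sw]]|].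
  by exists u, w.
by case=> u [w [uS wS su sw]]; split; apply/exists_inP; [exists u | exists w].
Qed.

Lemma bisided_pair S u w : u \in S -> w \in S -> side u != side w -> bisided S.
Proof.
move=> uS wS; case su: (side u); case sw: (side w) => // _; apply/bisidedP.
  by exists u, w; rewrite su sw.
by exists w, u; rewrite su sw.
Qed.

Lemma bisided2 u w : bisided [set u; w] = (side u != side w).
Proof.
apply/idP/idP => [/bisidedP[p [q []]]|]; last first.
  by apply: bisided_pair; rewrite !inE eqxx ?orbT.
by rewrite !inE => /orP[]/eqP-> /orP[]/eqP-> => [-> //|||-> //];
  case: (side u); case: (side w).
Qed.

Lemma bisidedS S T : S \subset T -> bisided S -> bisided T.
Proof.
move/subsetP => ST /bisidedP[u [w [uS wS su sw]]]; apply/bisidedP.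
by exists u, w; rewrite !ST.
Qed.

Lemma bicliqueP S :
  reflect (bisided S /\ {in S &, forall u w, side u != side w -> edge u w})
          (biclique S).
Proof.
apply: (iffP andP) => -[bS eS]; split=> //.
  move=> u w uS wS suw; have /forall_inP/(_ _ uS) := eS.
  by move/forall_inP/(_ _ wS)/implyP; exact.
apply/forall_inP => u uS; apply/forall_inP => w wS; apply/implyP; exact: eS.
Qed.

Lemma bicliqueS S T : S \subset T -> bisided S -> biclique T -> biclique S.
Proof.
move/subsetP => ST bS /bicliqueP[_ eT]; apply/bicliqueP; split=> // u w uS wS.
by apply: eT; exact: ST.
Qed.

Lemma biclique_bisided S : biclique S -> bisided S.
Proof. by case/andP. Qed.

Lemma extend0_biclique i (y : biclique_space i) S : ~~ biclique S ->
  extend0 y S = 0.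
Proof. by move=> nS; rewrite extend0_out // /biclique_index (negPf nS). Qed.

Lemma extend0_cards i (y : biclique_space i) S : #|S| != i.+2 ->
  extend0 y S = 0.
Proof. by move=> nS; rewrite extend0_out // /biclique_index (negPf nS) andbF. Qed.

Lemma bisided_removal T : bisided T -> (2 < #|T|)%N ->
  exists2 u, u \in T & bisided (T :\ u).
Proof.
move=> /bisidedP[p [q [pT qT sp sq]]] cT.
have [r] : exists r, r \in T :\ p :\ q.
  apply/card_gt0P; rewrite lt0n; apply: contraTneq cT => c0.
  by rewrite (cardsD1 p) (cardsD1 q (T :\ p)) c0 pT; case: (q \in _).
rewrite !inE => /and3P[rq rp rT]; exists r => //; apply/bisidedP.
by exists p, q; rewrite !inE pT qT ![_ == r]eq_sym rp rq.
Qed.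

Lemma inversion_sign_mul u w : inversion_sign u w * inversion_sign u w = 1.
Proof. by rewrite /inversion_sign; case: ifP; rewrite ?mulrNN mulr1. Qed.

Lemma inversion_signC u w : u != w ->
  inversion_sign w u = - inversion_sign u w.
Proof.
move=> nuw; rewrite /inversion_sign.
by case: ltngtP => [||/rank_inj e]; rewrite ?opprK //; rewrite e eqxx in nuw.
Qed.

(** Both [u] and [w] lie on the side opposite to [b], and one side is ranked entirely before the
    other. *)
Lemma inversion_sign_side b u w : side u != side b -> side w != side b ->
  inversion_sign b u = inversion_sign b w.
Proof.
rewrite /inversion_sign; case sb: (side b); case su: (side u) => // _;
  case sw: (side w) => // _.
  by rewrite !ifN // -leqNgt ltnW // rank_side ?su ?sw ?sb.
by rewrite !rank_side ?su ?sw ?sb.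
Qed.

Lemma insertion_sign_mul u S : insertion_sign u S * insertion_sign u S = 1.
Proof. by rewrite -big_split big1 // => w _; exact: inversion_sign_mul. Qed.

Lemma insertion_signU1 u w S : w \notin S ->
  insertion_sign u (w |: S) = inversion_sign w u * insertion_sign u S.
Proof. exact: big_setU1. Qed.

Lemma insertion_sign_neq0 u S : insertion_sign u S != 0.
Proof.
by apply: contra_eqN (insertion_sign_mul u S) => /eqP->; rewrite mul0r eq_sym oner_eq0.
Qed.

(** Inserting [u] and [w] in the other order changes only the comparison between these two. *)
Lemma insertion_sign_anticomm u w S : u != w -> u \notin S -> w \notin S ->
  insertion_sign w S * insertion_sign u (w |: S) =
  - (insertion_sign u S * insertion_sign w (u |: S)).
Proof.
move=> nuw uS wS; rewrite !insertion_signU1 // (inversion_signC nuw).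
by rewrite mulNr mulrN mulrCA [insertion_sign w S * _]mulrC mulrCA.
Qed.

(** A bisided subset of a biclique is a biclique, so the restriction to indices discards only sets
    that are not bisided. *)
Lemma biclique_mapE i u (y : biclique_space i.+1) S :
  extend0 (biclique_map u y) S =
  if (u \in S) || ~~ bisided S then 0
  else insertion_sign u S * extend0 y (u |: S).
Proof.
have [iS|niS] := boolP (biclique_index i S).
  by rewrite restrict_in // (biclique_bisided (proj1 (andP iS))) orbF.
rewrite extend0_out //; case: (boolP (u \in S)) => //= uS.
case: (boolP (bisided S)) => //= bS; rewrite extend0_out ?mulr0 //.
apply: contra niS => /andP[bc]; rewrite cardsU1 uS eqSS /biclique_index => ->.
by rewrite andbT (bicliqueS _ bS bc) ?subsetUr.
Qed.

(* Unlike linear_syzygy, this constrains also sets S inside one side, which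
   do not index basis elements; it has the same form at level 0. *)
Let cocycle i (z : V -> biclique_space i) : Prop :=
  (forall u S, u \in S -> extend0 (z u) S = 0) /\
  (forall S u w, #|S| = i.+1 -> u != w -> u \notin S -> w \notin S ->
     bisided (u |: S) -> bisided (w |: S) ->
     insertion_sign w S * extend0 (z u) (w |: S) +
     insertion_sign u S * extend0 (z w) (u |: S) = 0).

(** The formula of [biclique_map] dictates [y T] from any [u] whose removal leaves [T] bisided; the
    cocycle relation makes the choice of [u] irrelevant. *)
Lemma cocycle_integral i (z : V -> biclique_space i) : cocycle z ->
  exists y, forall u, z u = biclique_map u y.
Proof.
case=> U1 U2.
exists (restrict _ (fun T => if [pick u in T | bisided (T :\ u)] is Some u
  then insertion_sign u (T :\ u) * extend0 (z u) (T :\ u) else 0)) => u.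
apply: extend0_inj => S; rewrite biclique_mapE.
have [bcS|nbcS] := boolP (biclique S); last first.
  rewrite extend0_biclique //; case: ifPn => // /norP[uS /negPn bS].
  rewrite extend0_biclique ?mulr0 //; apply: contra nbcS.
  exact/bicliqueS/bS/subsetUr.
have [cS|ncS] := eqVneq #|S| i.+2; last first.
  rewrite extend0_cards //; case: ifPn => // /norP[uS _].
  by rewrite extend0_cards ?mulr0 // cardsU1 uS eqSS.
have bS := biclique_bisided bcS; rewrite bS orbF.
case: ifPn => [uS|uS]; first exact: U1.
have cD w : w \in S -> #|S :\ w| = i.+1.
  by move=> wS; have := cardsD1 w S; rewrite wS cS => -[].
have nuw w : w \in S -> u != w by apply: contraTneq => <-.
have uD w : u \notin S :\ w by rewrite inE (negPf uS) andbF.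
have [bcT|nbcT] := boolP (biclique (u |: S)); last first.
  rewrite (extend0_biclique _ nbcT) mulr0.
  have [b bS' [sb nadj]] : exists2 b, b \in S & side b != side u /\
      ~~ (edge u b && edge b u).
    suff /existsP[b /and3P[? ? ?]] : [exists b, [&& b \in S, side b != side u &
        ~~ (edge u b && edge b u)]] by exists b.
    apply: contraNT nbcT => /existsPn nb; apply/bicliqueP; split.
      exact/bisidedS/bS/subsetUr.
    have /bicliqueP[_ eS] := bcS.
    move=> p q; rewrite !inE => /predU1P[->|pS] /predU1P[->|qS].
    - by rewrite eqxx.
    - move=> suq; have := nb q.
      by rewrite qS eq_sym suq negbK => /andP[].
    - by move=> spu; have := nb p; rewrite pS spu negbK => /andP[].
    exact: eS.
  (* Replacing [w] by [u] in [S] keeps the non-adjacent pair [u], [b], so the partner term in the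
     cocycle relation vanishes and forces [z u] to vanish at [S]. *)
  have [w wS sw] : exists2 w, w \in S & side w = side u.
    have /bisidedP[p [q [pS qS sp sq]]] := bS.
    by case: (side u); [exists p | exists q => //; apply: negbTE].
  have nwb : b != w by apply: contraNneq sb => ->; rewrite sw.
  have bw : bisided (u |: (S :\ w)).
    by apply: (@bisided_pair _ b u); rewrite ?inE ?eqxx ?nwb ?bS' ?orbT.
  have := U2 (S :\ w) u w (cD w wS) (nuw w wS) (uD w); rewrite !inE eqxx.
  rewrite setD1K // => /(_ isT bw bS)/eqP.
  rewrite [extend0 (z w) _]extend0_biclique ?mulr0 ?addr0.
    by rewrite mulf_eq0 (negPf (insertion_sign_neq0 _ _)) => /eqP.
  apply: contra nadj => /bicliqueP[_ e].
  by rewrite !e ?inE ?eqxx ?nwb ?bS' ?orbT // eq_sym.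
rewrite restrict_in /biclique_index ?bcT ?cardsU1 ?uS ?cS ?eqxx //.
(* The vertex [u] is a candidate, so the pick succeeds; if it returns another [w], the relation at
   [S :\ w] compares the two values. *)
case: pickP => [w|/(_ u)]; last by rewrite !inE eqxx setU1K // bS.
case/andP; rewrite 2!inE => /predU1P[->|wS] bw.
  by rewrite setU1K // mulrA insertion_sign_mul mul1r.
have eT : (u |: S) :\ w = u |: (S :\ w).
  apply/setP => x; rewrite !inE; case: (eqVneq x u) => // ->.
  by rewrite nuw.
rewrite eT in bw *; have := U2 _ _ _ (cD w wS) (nuw w wS) (uD w).
rewrite !inE eqxx setD1K // => /(_ isT bw bS) e.
have sgn := insertion_sign_anticomm (nuw w wS) (uD w) (negbT (setD11 _ _)).
rewrite setD1K // in sgn.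
apply: (mulfI (insertion_sign_neq0 w (S :\ w))).
rewrite !mulrA sgn !mulNr -[X in - (X * _)]mulrA insertion_sign_mul mulr1.
by apply/eqP; rewrite -addr_eq0 e.
Qed.

Lemma biclique_map_inj i (y : biclique_space i.+1) :
  (forall u, biclique_map u y = 0) -> y = 0.
Proof.
move=> y0; apply: extend0_inj => T; rewrite extend00.
have [/andP[bT /eqP cT]|nT] := boolP (biclique_index i.+1 T); last first.
  by rewrite extend0_out.
have [|u uT bu] := bisided_removal (biclique_bisided bT); first by rewrite cT.
have := biclique_mapE u y (T :\ u); rewrite y0 extend00 setD11 bu setD1K //=.
move/esym/eqP; rewrite mulf_eq0 (negPf (insertion_sign_neq0 _ _)).
by move/eqP.
Qed.

Lemma biclique_map_linear i u : linear (@biclique_map i u).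
Proof.
move=> a y z; apply: extend0_inj => S; rewrite extend0_linear !biclique_mapE.
by case: ifP; rewrite ?mulr0 ?addr0 // extend0_linear mulrDr mulrCA.
Qed.

(** Here [S] is a single vertex [b] with [u] and [w] on the opposite side: the two signs agree, and
    in the sum over {u, w, b} the term at the one-sided pair {u, w} drops out. *)
Lemma biclique_syzygy_cocycle (z : V -> biclique_space 0) :
  biclique_syzygy z -> cocycle z.
Proof.
case=> z0 z3; split=> // S u w /eqP/cards1P[b ->] nuw.
rewrite !inE => nub nwb.
rewrite !bisided2 => su sw.
rewrite /insertion_sign !big_set1 (inversion_sign_side su sw) -mulrDr.
suff -> : extend0 (z u) (w |: [set b]) + extend0 (z w) (u |: [set b]) = 0.
  by rewrite mulr0.
pose T := u |: (w |: [set b]).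
have uT : u \notin w |: [set b] by rewrite !inE negb_or nuw.
have wT : w \notin u |: [set b] by rewrite !inE negb_or eq_sym nuw.
have bT : b \notin u |: [set w] by rewrite !inE negb_or ![b == _]eq_sym nub.
have eT1 : T = w |: (u |: [set b]) by rewrite /T setUCA.
have eT2 : T = b |: (u |: [set w]) by rewrite /T setUA setUC.
have cT : #|T| = 3 by rewrite !cardsU1 uT cards1 !inE nwb.
rewrite -(z3 T cT) (bigD1 u) ?inE ?eqxx //= setU1K //; congr (_ + _).
rewrite (bigD1 w) ?inE ?eqxx ?orbT 1?eq_sym //= {1}eT1 setU1K //.
rewrite big1 ?addr0 // => x /andP[/andP[]].
rewrite !inE => /or3P[]/eqP -> //; rewrite ?eqxx // => _ _.
rewrite eT2 setU1K // extend0_biclique //; apply: contra su => /biclique_bisided.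
by rewrite bisided2; case: (side u) sw; case: (side w); case: (side b).
Qed.

(** A triple that is a biclique has one vertex [b] alone on its side. The term at the pair of the
    other two, [p] and [q], is zero, and the remaining two terms cancel by the signs. *)
Lemma biclique_map_syzygy (y : biclique_space 1) :
  biclique_syzygy (fun u => biclique_map u y).
Proof.
split=> [u S uS|T cT]; first by rewrite biclique_mapE uS.
have [bT|nT] := boolP (biclique T); last first.
  apply: big1 => u uT; rewrite biclique_mapE setD1K //.
  by rewrite extend0_biclique // mulr0 if_same.
have [b [p [q [eT nbp nbq npq [sp sq]]]]] : exists b p q,
    [/\ T = b |: (p |: [set q]), b != p, b != q, p != q &
        side p != side b /\ side q != side b].
  have /biclique_bisided/bisidedP[p [q [pT qT sp /negPf sq]]] := bT.
  have npq : p != q by apply: contraTneq sp => ->; rewrite sq.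
  have [r rT /andP[nrp nrq]] : exists2 r, r \in T & (r != p) && (r != q).
    apply/exists_inP; apply: contra_eqT cT => /exists_inPn T2.
    have /subset_leq_card : T \subset p |: [set q].
      apply/subsetP => r rT; have := T2 r rT.
      by rewrite !inE negb_and !negbK.
    by rewrite cards2 npq; apply: contraTneq => ->.
  have eT : T = r |: (p |: [set q]).
    apply/esym/eqP; rewrite eqEcard cT !cardsU1 !inE cards1 negb_or nrp nrq npq.
    by rewrite !subUset !sub1set pT qT rT.
  case sr: (side r).
    exists q, p, r; split; rewrite 1?eq_sym // ?sp ?sq ?sr //.
    by apply/setP => x; rewrite eT !inE orbCA [RHS]orbCA; congr (_ || _); exact: orbC.
  exists p, q, r; split; rewrite // 1?eq_sym // ?sp ?sq ?sr //.
  by apply/setP => x; rewrite eT !inE orbCA; congr (_ || _); exact: orbC.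
transitivity (\sum_(u in b |: (p |: [set q]))
    extend0 (biclique_map u y) (T :\ u)); first by rewrite -eT.
rewrite !big_setU1 ?inE ?negb_or ?nbp //= big_set1 !biclique_mapE.
have [bTin pT qT] : [/\ b \in T, p \in T & q \in T].
  by rewrite eT !inE !eqxx !orbT.
have Tb : T :\ b = [set p; q] by rewrite eT setU1K // !inE negb_or nbp.
have Tp : T :\ p = [set b; q].
  by rewrite eT setUCA setU1K // !inE negb_or eq_sym nbp.
have Tq : T :\ q = [set b; p].
  rewrite eT [p |: _]setUC setUCA setU1K //.
  by rewrite !inE negb_or ![q == _]eq_sym nbq.
rewrite !setD1K // !setD11 /= Tb Tp Tq !bisided2 ![side b == _]eq_sym sp sq.
have -> : side p != side q = false.
  by case: (side p) sp; case: (side q) sq; case: (side b).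
rewrite add0r /= -mulrDl !insertion_signU1 ?inE // /insertion_sign !big_set1.
rewrite (inversion_sign_side sp sq) (inversion_signC npq).
by rewrite mulrN addNr mul0r.
Qed.

(** Exactness of the biclique complex along its linear strand. All levels reduce to [cocycle]; above
    level 0 the syzygy equations hold information at bisided sets only, and the other cases have to
    be deduced. *)
Lemma biclique_parametrizes i :
  parametrizes (@biclique_map i)
    (syzygy_condition biclique_map biclique_syzygy (i := i)).
Proof.
split; [exact: biclique_map_linear | | exact: biclique_map_inj].
case: i => [|i] z /=.
  split=> [/biclique_syzygy_cocycle/cocycle_integral //|[y zE]].
  have [y0 y3] := biclique_map_syzygy y.
  split=> [u S uS|T cT]; first by rewrite zE y0.
  by rewrite -[RHS](y3 T cT); apply: eq_bigr => u _; rewrite zE.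
split=> [[z0 z1]|[y zE]].
  apply: cocycle_integral.
  (* [Z0] comes from the coefficient at x_u^2, [Z1] from the one at x_u x_w. *)
  have Z0 u S : u \notin S -> bisided S -> extend0 (z u) (u |: S) = 0.
    move=> uS bS; have := congr1 (fun y => extend0 y S) (z0 u).
    rewrite extend00 biclique_mapE (negPf uS) bS /= => /eqP.
    by rewrite mulf_eq0 (negPf (insertion_sign_neq0 _ _)) => /eqP.
  have Z1 u w S : u != w -> bisided S ->
      (if w \in S then 0 else insertion_sign w S * extend0 (z u) (w |: S)) +
      (if u \in S then 0 else insertion_sign u S * extend0 (z w) (u |: S)) = 0.
    move=> nuw bS; have := congr1 (fun y => extend0 y S) (z1 u w nuw).
    by rewrite extend00 extend0D !biclique_mapE bS !orbF.
  split=> [u S uS|S u w cS nuw uS wS bu bw].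
    have [/andP[bS /eqP cS]|nS] := boolP (biclique_index i.+1 S); last first.
      by rewrite extend0_out.
    have [|r rS br] := bisided_removal (biclique_bisided bS); first by rewrite cS.
    have [eur|nur] := eqVneq u r.
      by rewrite -(setD1K uS) Z0 ?setD11 // eur.
    have := Z1 u r _ nur br; rewrite setD11 !inE nur uS /= setD1K // addr0.
    by move/eqP; rewrite mulf_eq0 (negPf (insertion_sign_neq0 _ _)) => /eqP.
  have [bS|nbS] := boolP (bisided S).
    by have := Z1 u w S nuw bS; rewrite (negPf uS) (negPf wS).
  (* S lies in one side: compare both terms with z_t for some t in S. *)
  have [t tS] : exists t, t \in S by apply/card_gt0P; rewrite cS.
  (* Above level 0 the set [S] has at least two elements; [q] survives the removal of [t] and keeps
     [x |: (S :\ t)] bisided. *)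
  have [q] : exists q, q \in S :\ t.
    by apply/card_gt0P; move: cS; rewrite (cardsD1 t) tS add1n => -[->].
  rewrite !inE => /andP[nqt qS].
  have opp x : bisided (x |: S) -> side x != side q.
    move=> bx; apply: contraNneq nbS => sx.
    have /bisidedP[p [r [pS rS sp sr]]] := bx; apply/bisidedP.
    move: pS rS; rewrite !inE => /predU1P[ep|pS] /predU1P[er|rS].
    - by move: sr; rewrite er -ep sp.
    - by exists q, r; split; rewrite // -sx -ep.
    - by exists p, q; split; rewrite // -sx -er.
    by exists p, r.
  have bQ x : bisided (x |: S) -> bisided (x |: (S :\ t)).
    move=> /opp sx; apply: (bisided_pair _ _ sx); rewrite !inE ?eqxx //.
    by rewrite nqt qS orbT.
  have ntS x : x \notin S -> x != t by apply: contraNneq => ->.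
  pose Q := S :\ t.
  have eS x : t |: (x |: Q) = x |: S by rewrite setUCA setD1K.
  have notinQ x y : x != y -> x \notin S -> x \notin y |: Q.
    by move=> nxy xS; rewrite !inE (negPf xS) (negPf nxy) andbF.
  have xQ x : x \notin S -> x \notin Q by move=> xS; rewrite inE (negPf xS) andbF.
  have tQ x : x \notin S -> t \notin x |: Q.
    by move=> xS; rewrite !inE eqxx orbF eq_sym ntS.
  have sS x : insertion_sign x S = inversion_sign t x * insertion_sign x Q.
    by rewrite -{1}(setD1K tS) insertion_signU1 ?setD11.
  have := Z1 u t (w |: Q) (ntS u uS) (bQ w bw).
  have := Z1 w t (u |: Q) (ntS w wS) (bQ u bu).
  rewrite !(negPf (tQ _ _)) // !(negPf (notinQ _ _ _ _)) // 1?eq_sym //.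
  rewrite !eS [w |: (u |: Q)]setUCA !sS !insertion_signU1 ?xQ //.
  rewrite (inversion_signC (ntS u uS)) (inversion_signC (ntS w wS)).
  rewrite (inversion_signC nuw) => e1 e2.
  (* Both [e1] and [e2] contain the value of [z t] at [u |: (w |: Q)]; the combination below
     eliminates it. *)
  apply: (mulfI (insertion_sign_neq0 t Q)); rewrite mulr0.
  apply: etrans (_ : _ = - insertion_sign w Q * 0 - insertion_sign u Q * 0) _;
    last by rewrite !mulr0 subrr.
  rewrite -{1}e2 -e1; ring.
(* Conversely, d squares to zero: the two orders of insertion carry opposite signs. *)
rewrite /linear_syzygy.
have zz u w S : bisided S -> extend0 (biclique_map w (z u)) S =
    if [|| w \in S, u \in S | u == w] then 0 else
    insertion_sign w S * insertion_sign u (w |: S) * extend0 y (u |: (w |: S)).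
  move=> bS; rewrite zE !biclique_mapE bS orbF !inE.
  rewrite (bisidedS (subsetUr _ _) bS) orbF.
  by case: (w \in S); case: (u \in S); case: (u == w); rewrite ?mulr0 ?mulrA.
split=> [u|u w nuw]; apply: extend0_inj => S; rewrite extend00.
  have [bS|nbS] := boolP (bisided S).
    by rewrite zz // eqxx !orbT.
  by rewrite biclique_mapE nbS orbT.
rewrite extend0D; have [bS|nbS] := boolP (bisided S); last first.
  by rewrite !biclique_mapE nbS !orbT addr0.
rewrite !zz // [w == u]eq_sym (negPf nuw) !orbF orbC.
case: ifPn => [_|/norP[wS uS]]; first by rewrite addr0.
rewrite insertion_sign_anticomm // [u |: (w |: S)]setUCA mulNr.
by rewrite addNr.
Qed.

End BicliqueStrand.

(** * Linear Betti numbers of bipartite graphs *)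

Section Comparison.

Local Open Scope ring_scope.
Import GRing.Theory.

Variables (K : fieldType) (n : nat) (side : pred 'I_n) (edge : rel 'I_n).
Local Notation R := {mpoly K[n]}.

(* Ordering one side before the other makes the signs at level 0 constant. *)
Definition side_rank (u : 'I_n) : nat := side u * n + u.

Lemma side_rank_inj : injective side_rank.
Proof.
move=> u w; rewrite /side_rank => e; apply: val_inj => /=.
have := congr1 (modn^~ n) e; rewrite /= !modnMDl !modn_small //.
Qed.

Lemma side_rank_lt u w : ~~ side u -> side w -> (side_rank u < side_rank w)%N.
Proof.
rewrite /side_rank => /negPf-> ->; rewrite mul0n mul1n add0n.
exact: leq_trans (ltn_ord u) (leq_addr _ _).
Qed.

Lemma mnm1_mesym1E (u : 'I_n) (S : {set 'I_n}) : u \notin S ->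
  (U_(u) + mesym1 S)%MM = mesym1 (u |: S).
Proof.
move=> uS; apply/mnmP => w; rewrite mnmDE mnm1E !mnmE !inE [w == u]eq_sym.
by case: eqP => // <-; rewrite (negPf uS).
Qed.

Lemma mnm1_mesym1_eq (u w : 'I_n) (S T : {set 'I_n}) :
  ((U_(u) + mesym1 S)%MM == mesym1 T) = (u \in T) && (S == T :\ u).
Proof.
apply/eqP/andP => [e|[uT /eqP->]]; last first.
  by rewrite mnm1_mesym1E ?setD11 // setD1K.
have uS : u \notin S.
  apply/negP => uS; have := congr1 (fun f : 'X_{1..n} => f u) e.
  by rewrite mnmDE mnm1E !mnmE eqxx uS; case: (_ \in _).
move: e; rewrite mnm1_mesym1E // => /inj_mesym1 <-.
by rewrite setU11 setU1K.
Qed.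

Lemma biclique_syzygyP (z : 'I_n -> biclique_space K side edge 0) :
  \sum_u 'X_u * (\sum_S extend0 (z u) S *: 'X_[mesym1 S]) = 0 :> R <->
  biclique_syzygy z.
Proof.
set s := \sum_u _.
have coef mu : s@_mu =
    \sum_u \sum_S extend0 (z u) S * ((U_(u) + mesym1 S)%MM == mu)%:R.
  rewrite raddf_sum; apply: eq_bigr => u _; rewrite mulr_sumr raddf_sum.
  by apply: eq_bigr => S _; rewrite -scalerAr -mpolyXD /= mcoeffZ mcoeffX.
have coefT T : s@_(mesym1 T) = \sum_(u in T) extend0 (z u) (T :\ u).
  rewrite coef [RHS]big_mkcond; apply: eq_bigr => u _.
  rewrite (bigD1 (T :\ u)) //= mnm1_mesym1_eq // eqxx andbT big1 ?addr0.
    by case: (u \in T); rewrite ?mulr1 ?mulr0.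
  by move=> S nS; rewrite mnm1_mesym1_eq // (negPf nS) andbF mulr0.
split=> [s0|[z0 z3]].
  split=> [u S uS|T _]; last by rewrite -coefT s0 mcoeff0.
  have := coef (U_(u) + mesym1 S)%MM; rewrite s0 mcoeff0 (bigD1 u) //=.
  rewrite (bigD1 S) //= eqxx mulr1 !big1 ?addr0 => [->//|w nwu|T nTS].
    rewrite big1 // => T _; case: eqP => [|_]; last by rewrite mulr0.
    move/(congr1 (fun f : 'X_{1..n} => f u)).
    by rewrite !mnmDE !mnm1E (negPf nwu) eqxx !mnmE uS; case: (_ \in _).
  rewrite eqm_add2l (inj_eq (@inj_mesym1 _)) (negPf nTS) mulr0 //.
apply/mpolyP => mu; rewrite mcoeff0.
(* Away from squarefree cubic monomials every term vanishes separately. *)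
have [[T /andP[/eqP cT /eqP->]]|nT] :=
    pickP (fun T : {set 'I_n} => (#|T| == 3) && (mu == mesym1 T)).
  by rewrite coefT z3.
rewrite coef big1 // => u _; rewrite big1 // => S _.
have [uS|uS] := boolP (u \in S); first by rewrite z0 ?mul0r.
have [cS|cS] := eqVneq #|S| 2; last by rewrite extend0_cards ?mul0r.
have := nT (u |: S); rewrite cardsU1 uS cS /= mnm1_mesym1E // eq_sym => ->.
by rewrite mulr0.
Qed.

Variables (I : R -> Prop) (F : free_seq K n).
Hypothesis minF : minimal_graded_free_resolution I F.
Hypothesis I_scale : forall c p, I p -> I (c *: p).
Hypothesis I_order2 : forall p mu, I p -> (mdeg mu <= 1)%N -> p@_mu = 0.
Hypothesis I_edge : forall (c : {set 'I_n} -> K),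
  I (\sum_(S | biclique_index side edge 0 S) c S *: 'X_[mesym1 S]).
Hypothesis I_quadratic : forall p mu, I p -> mdeg mu = 2 -> p@_mu != 0 ->
  exists2 S, biclique_index side edge 0 S & mu = mesym1 S.

(** By [I_edge] and [I_quadratic] the quadratic part of [I] has as basis the monomials x_S with [S]
    a two-element biclique. This matches the two strands at level 0, and [linear_strand_unique]
    carries the match to all levels. *)
Lemma linear_betti_bicliques i :
  graded_betti F i.+1 i.+2 = #|[set S | biclique_index side edge i S]|.
Proof.
have [b0 [b0_unique b0_shift b0_aug]] := resolution_start minF I_scale I_order2.
have parF := strand_parametrizes minF I_scale I_order2 b0_unique b0_shift b0_aug.
have parV := @biclique_parametrizes K _ side edge _ side_rank_inj side_rank_lt.
pose Q := @strand_quadric K n F b0.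
have Q_mem y : I (Q y) := strand_quadric_mem minF I_scale b0_unique b0_aug y.
have Q_homog y : Q y \is 2.-homog.
  exact: (strand_quadric_homog minF b0_shift y).
pose phi (y : strand F 0) : biclique_space K side edge 0 :=
  restrict _ (fun S => (Q y)@_(mesym1 S)).
have phiE y : Q y = \sum_S extend0 (phi y) S *: 'X_[mesym1 S].
  apply/mpolyP => mu; rewrite [RHS]raddf_sum /=.
  have [Q0|nz] := eqVneq (Q y)@_mu 0.
    rewrite Q0 big1 // => S _; rewrite mcoeffZ mcoeffX.
    case: eqP => [eS|_]; last by rewrite mulr0.
    have [iS|nS] := boolP (biclique_index side edge 0 S).
      by rewrite restrict_in // eS Q0 mul0r.
    by rewrite extend0_out ?mul0r.
  have mu2 : mdeg mu = 2.
    by apply/eqP; apply: contraNT nz => ne; rewrite (dhomog_nemf_coeff (Q_homog y)).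
  have [S iS ->] := I_quadratic (Q_mem y) mu2 nz.
  rewrite (bigD1 S) //= mcoeffZ mcoeffX eqxx mulr1 restrict_in // big1 ?addr0 //.
  move=> T nT; rewrite mcoeffZ mcoeffX (inj_eq (@inj_mesym1 _)) (negPf nT).
  by rewrite mulr0.
have Q_linear a y z : Q (a *: y + z) = a *: Q y + Q z.
  exact: strand_quadric_linear.
have phi_linear : linear phi.
  move=> a y z; apply/ffunP => S; rewrite !ffunE Q_linear mcoeffD mcoeffZ.
  by [].
have phi_bij : linear_bijection phi.
  split=> // [y z eq_yz|z].
    apply/eqP; rewrite -subr_eq0; apply/eqP.
    apply: (strand_quadric_ker minF b0_unique).
    by rewrite -scaleN1r addrC -/(Q _) Q_linear phiE [Q y]phiE eq_yz scaleN1r addNr.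
  have [y yE] := strand_quadric_surj minF I_scale I_order2 b0_unique b0_shift b0_aug
    (I_edge (extend0 z)).
  exists y; apply: extend0_inj => S.
  have [iS|nS] := boolP (biclique_index side edge 0 S); last by rewrite !extend0_out.
  have cS : mdeg (mesym1 S) = 2 by rewrite mdeg_mesym1; case/andP: iS => _ /eqP.
  rewrite restrict_in // /Q yE // raddf_sum (bigD1 S) //= mcoeffZ mcoeffX eqxx.
  rewrite mulr1 big1 ?addr0 // => T /andP[_ nT].
  by rewrite mcoeffZ mcoeffX (inj_eq (@inj_mesym1 _)) (negPf nT) mulr0.
have transfer (v : 'I_n -> strand F 0) :
    quadric_syzygy b0 v <-> biclique_syzygy (fun u => phi (v u)).
  rewrite -biclique_syzygyP /quadric_syzygy.
  by under eq_bigr do rewrite -/(Q _) phiE.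
have [psi psi_bij] := linear_strand_unique parF parV phi_bij transfer i.
rewrite /graded_betti cardsE -card_sig (linear_bijection_card psi_bij).
by rewrite card_sig cardsE.
Qed.

End Comparison.

Lemma biclique_index_imset (V W : finType) (f : V -> W) (side : pred W)
    (edge : rel W) i (S : {set V}) : injective f ->
  biclique_index side edge i (f @: S) =
  biclique_index (fun u => side (f u)) (fun u w => edge (f u) (f w)) i S.
Proof.
move=> injf; rewrite /biclique_index card_imset //; congr (_ && _).
have bE : bisided side (f @: S) = bisided (fun u => side (f u)) S.
  apply/bisidedP/bisidedP => [[_ [_ [/imsetP[u uS ->] /imsetP[w wS ->] su sw]]]|].
    by exists u, w.
  by case=> u [w [uS wS su sw]]; exists (f u), (f w); rewrite !imset_f.
apply/bicliqueP/bicliqueP; rewrite bE => -[bS eS]; split=> //.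
  by move=> u w uS wS; apply: eS; rewrite imset_f.
by move=> _ _ /imsetP[u uS ->] /imsetP[w wS ->]; exact: eS.
Qed.

(** * The quadratic part of the edge ideal of a bipartite graph *)

Section BipartiteEdgeIdeal.

Local Open Scope ring_scope.
Import GRing.Theory.

Variables (K : fieldType) (G : sgraph) (side : pred G).
Hypothesis bipartite : forall u w : G, adj u w -> side u != side w.

Local Notation R := {mpoly K[#|G|]}.
Local Notation var v := ('X_(enum_rank v) : R).

Let vside : pred 'I_#|G| := fun u => side (enum_val u).
Let vedge : rel 'I_#|G| := fun u w => adj (enum_val u) (enum_val w).

Lemma edge_ideal_mcoeff (c : G * G -> R) mu : (mdeg mu <= 2)%N ->
  (\sum_(e : G * G | adj e.1 e.2) c e * (var e.1 * var e.2))@_mu =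
  \sum_(e : G * G | adj e.1 e.2) (c e)@_0%MM *
    ((U_(enum_rank e.1) + U_(enum_rank e.2))%MM == mu)%:R.
Proof.
move=> mu2; rewrite raddf_sum; apply: eq_bigr => e _ /=.
rewrite -mpolyXD (@mcoeff_mulr_homog _ _ _ _ 2) ?mcoeffX //.
by rewrite dhomogX /= mdegD !mdeg1.
Qed.

Lemma edge_ideal_scale c p :
  @edge_ideal K G p -> @edge_ideal K G (c *: p).
Proof.
case=> d ->; exists (fun e => c *: d e); rewrite scaler_sumr.
by apply: eq_bigr => e _; rewrite scalerAl.
Qed.

Lemma edge_ideal_order2 p mu :
  @edge_ideal K G p -> (mdeg mu <= 1)%N -> p@_mu = 0.
Proof.
case=> c -> mu1; rewrite edge_ideal_mcoeff; last exact: leqW.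
apply: big1 => e _; case: eqP mu1 => [<-|]; last by rewrite mulr0.
by rewrite mdegD !mdeg1.
Qed.

Lemma mesym1_pair n (u w : 'I_n) : u != w ->
  (U_(u) + U_(w))%MM = mesym1 [set u; w].
Proof. by move=> nuw; rewrite -(mesym1_set1 w) mnm1_mesym1E // inE. Qed.

Lemma edge_ideal_quadratic p mu : @edge_ideal K G p -> mdeg mu = 2 ->
  p@_mu != 0 -> exists2 S, biclique_index vside vedge 0 S & mu = mesym1 S.
Proof.
case=> c -> mu2; rewrite edge_ideal_mcoeff ?mu2 // => nz.
have /existsP[[u w] /andP[/= uw /eqP <-]] : [exists e : G * G, adj e.1 e.2 &&
    (U_(enum_rank e.1) + U_(enum_rank e.2) == mu)%MM].
  apply: contraNT nz => /existsPn none; rewrite big1 // => e e12.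
  by have := none e; rewrite e12 /= => /negPf->; rewrite mulr0.
have nuw : u != w by apply: contraTneq uw => ->; rewrite adj_irrefl.
rewrite mesym1_pair ?(inj_eq enum_rank_inj) //.
exists [set enum_rank u; enum_rank w] => //.
have -> : [set enum_rank u; enum_rank w] = enum_rank @: [set u; w].
  by rewrite imsetU1 imset_set1.
rewrite biclique_index_imset; last exact: enum_rank_inj.
rewrite /biclique_index cards2 nuw andbT; apply/bicliqueP; split.
  by rewrite bisided2 /vside !enum_rankK bipartite.
move=> x y; rewrite !inE /vside /vedge !enum_rankK.
by move=> /orP[]/eqP-> /orP[]/eqP->; rewrite ?eqxx // adj_sym.
Qed.

Lemma edge_ideal_edge (c : {set 'I_#|G|} -> K) : @edge_ideal K G
  (\sum_(S | biclique_index vside vedge 0 S) c S *: 'X_[mesym1 S]).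
Proof.
(* The generators list each edge in both orientations; [pr] selects one, so that [S] is counted
   once. *)
pose pr (S : {set 'I_#|G|}) : option (G * G) :=
  [pick e | adj e.1 e.2 & S == [set enum_rank e.1; enum_rank e.2]].
exists (fun e => (\sum_(S | biclique_index vside vedge 0 S)
  c S * (pr S == Some e)%:R)%:MP).
under [RHS]eq_bigr do rewrite mul_mpolyC scaler_suml.
rewrite exchange_big; apply: eq_bigr => S iS.
have : exists e : G * G, adj e.1 e.2 && (S == [set enum_rank e.1; enum_rank e.2]).
  case/andP: iS => /bicliqueP[/bisidedP[u [w [uS wS su sw]]] eS] cS.
  have := eS u w uS wS; rewrite su (negPf sw) => /(_ isT) uw.
  exists (enum_val u, enum_val w); rewrite /= !enum_valK -/(vedge u w) uw /=.
  rewrite eq_sym eqEcard (eqP cS) cards2 subUset !sub1set uS wS.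
  by rewrite (contraNneq _ sw) // => <-.
case=> e0 he0; case prS: (pr S) => [e|]; last first.
  by move: prS; rewrite /pr; case: pickP => // /(_ e0); rewrite he0.
move: (prS); rewrite /pr; case: pickP => // e' /andP[e12 /eqP eS] [ee].
rewrite ee in e12 eS; rewrite (bigD1 e) //= big1 ?addr0 => [|f /andP[_ nf]].
  rewrite eqxx mulr1 eS -mesym1_pair ?mpolyXD //.
  by rewrite (inj_eq enum_rank_inj); apply: contraTneq e12 => ->; rewrite adj_irrefl.
by rewrite (inj_eq Some_inj) eq_sym (negPf nf) mulr0 scale0r.
Qed.

Theorem bipartite_linear_betti (F : free_seq K #|G|) i :
    minimal_graded_free_resolution (@edge_ideal K G) F ->
  graded_betti F i.+1 i.+2 = #|[set S | biclique_index side (@adj G) i S]|.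
Proof.
move=> minF.
rewrite (linear_betti_bicliques minF edge_ideal_scale edge_ideal_order2
  edge_ideal_edge edge_ideal_quadratic).
rewrite -(card_imset _ (imset_inj (@enum_val_inj _ G))); apply: eq_card => S.
have inj := @enum_val_inj _ G.
have imK : enum_val @: (enum_rank @: S) = S :> {set G}.
  rewrite -imset_comp -[RHS]imset_id; apply: eq_imset => x /=.
  exact: enum_rankK.
apply/imsetP/idP => [[T]|]; rewrite !inE.
  by move=> iT ->; rewrite biclique_index_imset.
move=> iS; exists (enum_rank @: S); last by rewrite imK.
by rewrite inE -(biclique_index_imset _ _ _ _ inj) imK.
Qed.

End BipartiteEdgeIdeal.

(** * Counting bicliques of Kneser graphs *)

Section KneserBicliques.

Variables m k : nat.
Implicit Types (T : {set 'I_m}) (A B : {set {set 'I_m}}).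

Definition kneser_side (v : kneser_vertex m k) : bool :=
  if v is inr _ then true else false.

Lemma kneser_bipartite (u v : bipartite_kneser m k) :
  adj u v -> kneser_side u != kneser_side v.
Proof. by case: u v => [u|u] [v|v]. Qed.

Let uniform r A : bool := [forall X in A, #|X| == r].

Let cross_subset A B : bool := [forall X in A, forall Y in B, X \subset Y].

Let kneser_pair (AB : {set {set 'I_m}} * {set {set 'I_m}}) : bool :=
  [&& uniform k AB.1, uniform (m - k) AB.2 & cross_subset AB.1 AB.2].

(** Used with a, b the sizes of two families: each admissible pair of families is counted for
    exactly one (r, s). *)
Lemma sum_decompositions n a b :
  \sum_(1 <= r < n.+1) \sum_(1 <= s < n.+1 | r + s == n)
    ((r == a) && (s == b) : nat) = [&& 0 < a, 0 < b & a + b == n].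
Proof.
rewrite (eq_bigr (fun r => if r == a then
    \sum_(1 <= s < n.+1 | (r + s == n) && (s == b)) 1 else 0)) => [|r _].
  rewrite -big_mkcond /= big_nat1_eq big_nat1_cond_eq.
  case: a b => [|a] [|b] //=; first by rewrite if_same.
  by case: eqP => [<-|_]; rewrite ?andbF ?if_same // !ifT //; lia.
case: eqP => _; last by rewrite big1.
by rewrite big_mkcondr; apply: eq_bigr => s _; case: eqP.
Qed.

Lemma sum_set_card n (f : nat -> nat) :
  \sum_(T : {set 'I_n}) f #|T| = \sum_(0 <= t < n.+1) 'C(n, t) * f t.
Proof.
rewrite big_mkord (partition_big (fun T : {set 'I_n} => inord #|T| : 'I_n.+1) xpredT) //=.
apply: eq_bigr => t _.
have eqt (T : {set 'I_n}) : (inord #|T| == t) = (#|T| == t).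
  by rewrite -val_eqE /= inordK // ltnS -[X in _ <= X]card_ord max_card.
rewrite (eq_bigr (fun=> f t)) => [|T]; last by rewrite eqt => /eqP->.
rewrite sum_nat_const; congr (_ * _).
have := card_draws 'I_n t; rewrite card_ord => <-; apply: eq_card => T.
by rewrite inE -eqt.
Qed.

(** Sort the pairs by T, the intersection of the second family. The first family is then any choice
    of [r] among the [k]-subsets of T, independently of the second. *)
Lemma card_kneser_pairs r s : 0 < r -> 0 < s ->
  #|[set AB | [&& kneser_pair AB, #|AB.1| == r & #|AB.2| == s]]| =
  \sum_(k <= t < (m - k).+1) 'C('C(t, k), r) * 'C(m, t) * Nfamilies m s (m - k) t.
Proof.
move=> r_gt0 s_gt0.
pose f t := 'C('C(t, k), r) * Nfamilies m s (m - k) t.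
rewrite -sum1_card (partition_big (fun AB : {set {set 'I_m}} * {set {set 'I_m}} =>
  \bigcap_(X in AB.2) X) xpredT) //=.
transitivity (\sum_(T : {set 'I_m}) f #|T|).
  apply: eq_bigr => T _; rewrite sum1_card /f -card_families -!cards_draws -cardsX.
  apply: eq_card => -[A B]; rewrite [LHS]unfold_in /= !inE /= /kneser_pair /=.
  have [<-|_] := eqVneq (\bigcap_(X in B) X) T; last by rewrite !andbF.
  rewrite !andbT [X in _ = _ && X]andbC.
  have -> : (A \subset [set X : {set 'I_m} | X \subset \bigcap_(Y in B) Y & #|X| == k])
      = uniform k A && cross_subset A B.
    apply/subsetP/andP => [AT|[/forall_inP uA /forall_inP cAB] X XA].
      split; apply/forall_inP => X XA; have := AT X XA; rewrite inE => /andP[].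
        by [].
      by move=> /bigcapsP sX _; apply/forall_inP.
    by rewrite inE uA // andbT; apply/bigcapsP => Y; exact: (forall_inP (cAB X XA)).
  rewrite -/(uniform (m - k) B).
  case: (uniform k A); case: (uniform _ B); case: (cross_subset A B);
    by rewrite ?andbF ?andbT //= andbC.
rewrite sum_set_card.
(* For t < k there are no [k]-subsets to choose, and r > 0. For t > m - k the intersection would be
   larger than a member, which exists since s > 0. *)
have f0 t : ~~ (k <= t < (m - k).+1) -> 'C(m, t) * f t = 0.
  rewrite negb_and -!ltnNge ltnS => /orP[lt|lt].
    by rewrite /f (bin_small lt) (bin_small r_gt0) mul0n muln0.
  have [->|] := posnP 'C(m, t); first by rewrite mul0n.
  rewrite -[m in 'C(m, _)]card_ord -card_draws => /card_gt0P[T].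
  rewrite inE => /eqP cT; rewrite /f -cT -card_families.
  suff -> : families s (m - k) T = set0 by rewrite cards0 !muln0.
  apply/setP => B; rewrite !inE; apply/and3P => -[/eqP cB /forall_inP uB /eqP capB].
  have [Y YB] : exists Y, Y \in B by apply/card_gt0P; rewrite cB.
  have := subset_leq_card (bigcap_inf Y YB : \bigcap_(X in B) X \subset Y).
  by rewrite capB cT (eqP (uB Y YB)) leqNgt lt.
rewrite [RHS](big_nat_widenl _ 0) // (@big_nat_widen _ _ _ _ (m - k).+1 m.+1).
  rewrite [RHS]big_mkcond; apply: eq_bigr => t _ /=.
  by case: ifPn => [_|/f0->//]; rewrite /f mulnA [X in X * _]mulnC.
by rewrite ltnS leq_subr.
Qed.

Let parts (S : {set kneser_vertex m k}) : {set {set 'I_m}} * {set {set 'I_m}} :=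
  (val @: (inl @^-1: S), val @: (inr @^-1: S)).

Lemma parts_inj : injective parts.
Proof.
move=> S T [/(imset_inj val_inj) eA /(imset_inj val_inj) eB]; apply/setP => -[a|b].
  by have := congr1 (fun A : {set _} => a \in A) eA; rewrite !inE.
by have := congr1 (fun B : {set _} => b \in B) eB; rewrite !inE.
Qed.

Lemma parts_pair S : kneser_pair (parts S) = cross_subset (parts S).1 (parts S).2.
Proof.
have uni r (D : {set {X : {set 'I_m} | #|X| == r}}) :
    uniform r (val @: D).
  by apply/forall_inP => _ /imsetP[X _ ->]; exact: (valP X).
by rewrite /kneser_pair !uni.
Qed.

Lemma biclique_index_parts i S :
  biclique_index kneser_side (@kneser_adj m k) i S =
  [&& kneser_pair (parts S), 0 < #|(parts S).1|, 0 < #|(parts S).2| &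
      #|(parts S).1| + #|(parts S).2| == i.+2].
Proof.
rewrite parts_pair /biclique_index /biclique.
have -> : #|S| = #|(parts S).1| + #|(parts S).2|.
  rewrite !card_imset; try exact: val_inj.
  by rewrite -!sum1_card big_sumType; congr (_ + _); apply: eq_bigl => x; rewrite inE.
have -> : bisided kneser_side S = (0 < #|(parts S).1|) && (0 < #|(parts S).2|).
  apply/bisidedP/andP => [[u [w [uS wS su sw]]]|].
    case: u uS su => // b bS _; case: w wS sw => // a aS _.
    by split; apply/card_gt0P; [exists (val a) | exists (val b)];
      apply: imset_f; rewrite inE.
  case=> /card_gt0P[_ /imsetP[a aS _]] /card_gt0P[_ /imsetP[b bS _]].
  by exists (inr b), (inl a); split=> //; [move: bS | move: aS]; rewrite inE.
set E := [forall u in S, _]; have -> : E = cross_subset (parts S).1 (parts S).2.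
  apply/forall_inP/forall_inP => [eS _ /imsetP[a aS ->]|cS u uS].
    apply/forall_inP => _ /imsetP[b bS ->]; rewrite !inE in aS bS.
    by have := forallP (eS _ aS) (inr b); rewrite bS.
  apply/forall_inP => w wS; apply/implyP.
  case: u w uS wS => [a|b] [a'|b'] //= uS wS _.
    have aA : val a \in (parts S).1 by apply: imset_f; rewrite inE.
    by apply: (forall_inP (cS _ aA)); apply: imset_f; rewrite inE.
  have aA : val a' \in (parts S).1 by apply: imset_f; rewrite inE.
  by apply: (forall_inP (cS _ aA)); apply: imset_f; rewrite inE.
by case: (cross_subset _ _); rewrite ?andbF ?andbT //= -andbA.
Qed.

Lemma card_kneser_bicliques i :
  #|[set S | biclique_index kneser_side (@kneser_adj m k) i S]| =
  #|[set AB | [&& kneser_pair AB, 0 < #|AB.1|, 0 < #|AB.2| &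
      #|AB.1| + #|AB.2| == i.+2]]|.
Proof.
rewrite -(card_imset _ parts_inj); apply: eq_card => -[A B].
rewrite [RHS]inE; apply/imsetP/idP => [[S]|pAB].
  by rewrite inE biclique_index_parts => ? ->.
pose S : {set kneser_vertex m k} := [set v | match v with
  | inl a => val a \in A | inr b => val b \in B end].
have eS : parts S = (A, B).
  have /andP[/and3P[/forall_inP uA /forall_inP uB _] _] := pAB.
  congr pair; apply/setP => X; apply/imsetP/idP => [[x] + ->|XA]; rewrite ?inE //.
    by exists (exist _ X (uA X XA)); rewrite ?inE.
  by exists (exist _ X (uB X XA)); rewrite ?inE.
by exists S; rewrite ?inE ?biclique_index_parts eS.
Qed.

Lemma card_kneser_pairs_sum n :
  #|[set AB | [&& kneser_pair AB, 0 < #|AB.1|, 0 < #|AB.2| &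
      #|AB.1| + #|AB.2| == n]]| =
  \sum_(1 <= r < n.+1) \sum_(1 <= s < n.+1 | r + s == n)
    \sum_(k <= t < (m - k).+1) 'C('C(t, k), r) * 'C(m, t) * Nfamilies m s (m - k) t.
Proof.
rewrite [RHS](eq_big_nat _ _ (F2 := fun r =>
  \sum_(1 <= s < n.+1 | r + s == n) \sum_(AB | kneser_pair AB)
     ((r == #|AB.1|) && (s == #|AB.2|) : nat))).
  under [RHS]eq_bigr do rewrite exchange_big.
  rewrite [RHS]exchange_big /= -sum1_card.
  under [LHS]eq_bigl do rewrite inE.
  rewrite big_mkcondr; apply: eq_bigr => AB _.
  by rewrite sum_decompositions; case: ifP.
move=> r /andP[r_gt0 _]; rewrite big_nat_cond [RHS]big_nat_cond; apply: eq_bigr => s.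
case/andP=> /andP[s_gt0 _] _; rewrite -card_kneser_pairs // -sum1_card.
under eq_bigl do rewrite inE.
rewrite big_mkcondr; apply: eq_bigr => AB _.
by rewrite ![#|_| == _]eq_sym; case: ifP.
Qed.

End KneserBicliques.

Theorem theorem1p3 (K : fieldType) (K_infinite : infinite_field K)
    (m k : nat) (m_gt0 : 0 < m) (k_gt0 : 0 < k) (le_2k_m : 2 * k <= m)
    (F : free_seq K #|bipartite_kneser m k|)
    (F_min : minimal_graded_free_resolution
               (@edge_ideal K (bipartite_kneser m k)) F)
    (i : nat) (i_gt0 : 1 <= i) :
  graded_betti F i i.+1 =
    \sum_(1 <= r < i.+2) \sum_(1 <= s < i.+2 | r + s == i.+1)
      \sum_(k <= t < (m - k).+1)
        'C('C(t, k), r) * 'C(m, t) * Nfamilies m s (m - k) t.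
Proof.
case: i i_gt0 => // i _.
rewrite (bipartite_linear_betti (@kneser_bipartite m k) i F_min).
by rewrite card_kneser_bicliques card_kneser_pairs_sum.
Qed.
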